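(* Let $M$ be a symmetric positive definite real $n\times n$ matrix with distinct (real positive) eigenvalues $\lambda_1<\lambda_2<\dots<\lambda_p$ with multiplicities $h_1,\dots,h_p$ respectively, let $\mathcal{J}_M=\bigoplus_{i=1}^p\lambda_iI_{h_i}$, and let $Q\in\mathcal{O}_n$ be such that $M=Q\mathcal{J}_MQ^T$. Fix integers $0\le u_i\le h_i$ ($1\le i\le p$) and let $\widetilde{\mathcal{J}}=\bigoplus_{i=1}^p\sqrt{\lambda_i}\,(I_{u_i}\oplus(-I_{h_i-u_i}))$ be the RJA form of any $Y\in\mathcal{SSR}(M)_{(u_1,\dots,u_p)}$. Then $$\mathcal{SSR}(M)_{(u_1,\dots,u_p)}=\{QX\widetilde{\mathcal{J}}X^TQ^T:X\in\mathcal{C}_{\mathcal{J}_M}\cap\mathcal{O}_n\}=\Gamma_Q\big(\mathcal{SSR}(\mathcal{J}_M)_{(u_1,\dots,u_p)}\big),$$ where $$\mathcal{SSR}(\mathcal{J}_M)_{(u_1,\dots,u_p)}=\bigoplus_{i=1}^p\sqrt{\lambda_i}\,\big(\mathcal{O}_{h_i}\cap GLSym_{h_i}(u_i)\big).$$ Moreover $\mathcal{SSR}(M)_{(u_1,\dots,u_p)}$ is a compact submanifold of $GLSym_n(u)$ (with $u:=\sum_{i=1}^pu_i$), diffeomorphic to the homogeneous space $\dfrac{\mathcal{C}_{\mathcal{J}_M}\cap\mathcal{O}_n}{\mathcal{C}_{\widetilde{\mathcal{J}}}\cap\mathcal{O}_n}$.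
   Context: $GL_n$ is the group of real non-singular $n\times n$ matrices, $\mathcal{O}_n$ the group of real orthogonal $n\times n$ matrices. $GLSym_n(q)$ is the manifold of non-singular real symmetric $n\times n$ matrices with $q$ positive and $n-q$ negative eigenvalues. For $B\in GL_n$, $\mathcal{C}_B:=\{X\in GL_n:BX=XB\}$. For $Q\in GL_n$, $\Gamma_Q(X):=QXQ^T$. $\oplus$ denotes block-diagonal sum of matrices (blocks of size $0$ omitted); for sets of square matrices $\mathcal{S}_1,\dots,\mathcal{S}_m$, $\mathcal{S}_1\oplus\dots\oplus\mathcal{S}_m$ is the set of all $B_1\oplus\dots\oplus B_m$ with $B_j\in\mathcal{S}_j$. For a symmetric positive definite $M$ with distinct eigenvalues $\lambda_1<\dots<\lambda_p$ of multiplicities $h_1,\dots,h_p$ and integers $0\le u_i\le h_i$, $\mathcal{SSR}(M)_{(u_1,\dots,u_p)}$ is the set of real symmetric matrices $Y$ with $Y^2=M$ having, for every $i$, eigenvalue $\sqrt{\lambda_i}$ with multiplicity $u_i$ and eigenvalue $-\sqrt{\lambda_i}$ with multiplicity $h_i-u_i$; equivalently, those symmetric square roots $Y$ of $M$ whose real Jordan auxiliary form (RJA form) is $\widetilde{\mathcal{J}}=\bigoplus_{i=1}^p\sqrt{\lambda_i}\,(I_{u_i}\oplus(-I_{h_i-u_i}))$, i.e. $Y=R\widetilde{\mathcal{J}}R^T$ for some $R\in\mathcal{O}_n$. One has $\mathcal{C}_{\widetilde{\mathcal{J}}}\subseteq\mathcal{C}_{\mathcal{J}_M}$ since $\widetilde{\mathcal{J}}^2=\mathcal{J}_M$.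 *)

(* Defs.v *)
From HB Require Import structures.
From mathcomp Require Import all_boot all_order all_algebra.
From mathcomp Require Import all_classical all_reals all_analysis.

Set Implicit Arguments.
Unset Strict Implicit.
Unset Printing Implicit Defensive.

Import Order.TTheory GRing.Theory Num.Theory.
Import numFieldNormedType.Exports.

Local Open Scope classical_set_scope.
Local Open Scope ring_scope.

Section Matrices.
Variable R : realType.

Definition posdef n (A : 'M[R]_n) : Prop :=
  forall x : 'cV[R]_n, x != 0 -> 0 < (x^T *m A *m x) 0 0.

Definition orthogonal_group n : set 'M[R]_n := [set X | X *m X^T = 1%:M].

Definition centralizer n (B : 'M[R]_n) : set 'M[R]_n :=
  [set X | X \in unitmx /\ B *m X = X *m B].

(* The characteristic polynomial of a real symmetric matrix splits over R, so
   that s is the list of the eigenvalues of A with their multiplicities. *)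
Definition GLSym n (q : nat) : set 'M[R]_n :=
  [set A | [/\ A \in unitmx, A^T = A &
    exists s : seq R,
      [/\ char_poly A = \prod_(x <- s) ('X - x%:P),
          count (fun x => 0 < x) s = q &
          count (fun x => x < 0) s = (n - q)%N]]].

Definition Gamma n (Q X : 'M[R]_n) : 'M[R]_n := Q *m X *m Q^T.

(* Multiplicities are algebraic; a multiplicity 0 says that the number is not
   an eigenvalue. *)
Definition SSR n (M : 'M[R]_n) p (lam : 'I_p -> R) (h u : 'I_p -> nat) :
    set 'M[R]_n :=
  [set Y | [/\ Y^T = Y, Y *m Y = M &
    forall i, mup (Num.sqrt (lam i)) (char_poly Y) = u i /\
              mup (- Num.sqrt (lam i)) (char_poly Y) = (h i - u i)%N]].

Definition mxdiag_set p (h : 'I_p -> nat) (S : forall i, set 'M[R]_(h i)) :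
    set 'M[R]_(\sum_(i < p) h i) :=
  [set \mxdiag_(i < p) B i | B in [set B | forall i, S i (B i)]].

Definition Jordan p (lam : 'I_p -> R) (h : 'I_p -> nat) :
    'M[R]_(\sum_(i < p) h i) :=
  \mxdiag_(i < p) ((lam i)%:M : 'M[R]_(h i)).

(* pid_mx u = I_u (+) 0 and copid_mx u = 0 (+) I_(h - u), so that each block is
   sqrt(lam i) (I_u (+) - I_(h - u)) as soon as u i <= h i. *)
Definition RJA p (lam : 'I_p -> R) (h u : 'I_p -> nat) :
    'M[R]_(\sum_(i < p) h i) :=
  \mxdiag_(i < p)
    (Num.sqrt (lam i) *: (pid_mx (u i) - copid_mx (u i)) : 'M[R]_(h i)).

End Matrices.

Arguments orthogonal_group {R} n.
Arguments GLSym {R} n q.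

Section Smooth.
Variables (R : realType) (V W : normedModType R).

(* Meaningful when U is open and V is finite-dimensional, in which case the
   continuity of all the x |-> 'D_v f x is that of x |-> 'd f x. *)
Fixpoint Ck (k : nat) (U : set V) (f : V -> W) : Prop :=
  match k with
  | 0 => forall x, U x -> {for x, continuous f}
  | k'.+1 => (forall x, U x -> differentiable f x) /\
             (forall v, Ck k' U (fun x => 'D_v f x))
  end.

Definition smooth (U : set V) (f : V -> W) : Prop := forall k, Ck k U f.

(* Smoothness on an arbitrary subset A: local existence of smooth extensions. *)
Definition smooth_on (A : set V) (f : V -> W) : Prop :=
  forall x, A x -> exists (U : set V) (g : V -> W),
    [/\ open U, U x, smooth U g & forall y, (A `&` U) y -> f y = g y].

End Smooth.

(* A d-dimensional chart on (a part of) T; cinv is meant to be the inverse of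
   cmap on the image cod, and the values of cmap and cinv outside of dom and
   cod are irrelevant. *)
Record chart (R : realType) (T : Type) (d : nat) := Chart {
  dom : set T;
  cmap : T -> 'rV[R]_d;
  cinv : 'rV[R]_d -> T }.

Definition cod (R : realType) (T : Type) (d : nat) (c : chart R T d) :
  set 'rV[R]_d := cmap c @` dom c.

Definition chart_bij (R : realType) (T : Type) (d : nat) (c : chart R T d) :=
  open (cod c) /\ (forall x, dom c x -> cinv c (cmap c x) = x).

(* The maximal atlas of X as a d-dimensional embedded submanifold of V. *)
Definition embedded_atlas (R : realType) (V : normedModType R) (d : nat)
    (X : set V) : set (chart R V d) :=
  [set c | [/\ chart_bij c,
    exists2 U : set V, open U & dom c = X `&` U,
    smooth_on (dom c) (cmap c) &
    smooth_on (cod c) (cinv c)]].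
Arguments embedded_atlas {R V} d X.

Definition embedded_manifold (R : realType) (V : normedModType R) (d : nat)
    (X : set V) : Prop :=
  forall x, X x -> exists2 c, embedded_atlas d X c & dom c x.

(* S is a d-dimensional submanifold of the manifold N (itself embedded in V):
   around each point of S some chart of N maps S onto a slice
   R^d x {0} of its codomain. *)
Definition submanifold (R : realType) (V : normedModType R) (d : nat)
    (N S : set V) : Prop :=
  S `<=` N /\ exists D : nat,
    [/\ (d <= D)%N, embedded_manifold D N &
      forall x, S x -> exists c : chart R V D,
        [/\ embedded_atlas D N c, dom c x &
            cmap c @` (dom c `&` S) =
            cod c `&` [set v | forall j : 'I_D, (d <= j)%N -> v 0 j = 0]]].

Section Homogeneous.
Variables (R : realType) (n : nat).

Definition lcoset (H : set 'M[R]_n) (x : 'M[R]_n) : set 'M[R]_n :=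
  [set x *m k | k in H].

Definition coset_space (G H : set 'M[R]_n) : set (set 'M[R]_n) :=
  lcoset H @` G.

(* The maximal atlas of the homogeneous space G / H, for G a Lie group of
   matrices and H a closed subgroup of G: the smooth structure is the unique
   one, on G / H with the quotient topology, such that the projection
   lcoset H : G -> G / H is smooth and admits smooth local sections. *)
Definition homogeneous_atlas (d : nat) (G H : set 'M[R]_n) :
    set (chart R (set 'M[R]_n) d) :=
  [set c |
    let pre := [set x | G x /\ dom c (lcoset H x)] in
    [/\ chart_bij c,
        dom c `<=` coset_space G H,
        exists2 U : set 'M[R]_n, open U & pre = G `&` U,
        smooth_on pre (cmap c \o lcoset H) &
        forall y, cod c y -> exists (O : set 'rV[R]_d) (s : 'rV[R]_d -> 'M[R]_n),
          [/\ open O, O y, O `<=` cod c, smooth O s &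
              forall z, O z -> G (s z) /\ lcoset H (s z) = cinv c z]]].

End Homogeneous.

Arguments homogeneous_atlas {R n} d G H.

Definition smooth_map (R : realType) (T1 T2 : Type) (d1 d2 : nat)
    (X : set T1) (A : set (chart R T1 d1)) (B : set (chart R T2 d2))
    (f : T1 -> T2) : Prop :=
  forall x, X x -> exists a b,
    [/\ A a, B b, dom a x, f @` dom a `<=` dom b &
        smooth_on (cod a) (cmap b \o f \o cinv a)].

Definition diffeomorphic (R : realType) (T1 T2 : Type) (d1 d2 : nat)
    (X : set T1) (A : set (chart R T1 d1))
    (Y : set T2) (B : set (chart R T2 d2)) : Prop :=
  exists (f : T1 -> T2) (g : T2 -> T1),
    [/\ f @` X `<=` Y, g @` Y `<=` X,
        (forall x, X x -> g (f x) = x) /\ (forall y, Y y -> f (g y) = y),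
        smooth_map X A B f & smooth_map Y B A g].

(* Main.v *)
Require Import Defs.
From HB Require Import structures.
From mathcomp Require Import all_boot all_order all_algebra perm.
From mathcomp Require Import complex zify lra ring.
From mathcomp Require Import all_classical all_reals all_analysis.
Set Implicit Arguments.
Unset Strict Implicit.
Unset Printing Implicit Defensive.
Import Order.TTheory GRing.Theory Num.Theory.
Import numFieldNormedType.Exports.
Local Open Scope classical_set_scope.
Local Open Scope ring_scope.

(** After conjugation by [Q] the theorem is about the diagonal matrix
    [J = RJA lam h u], with diagonal [a] and square [Jordan lam h].  By the
    real spectral theorem a symmetric matrix is determined, up to orthogonal
    conjugation, by its characteristic polynomial, so the square roots with the
    prescribed multiplicities are the matrices [X J X^T] with [X] orthogonal,
    and the equation [(X J X^T)^2 = J^2] says that [X] commutes with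
    [J^2 = Jordan lam h].  This is [SSR_orbit]; as the commutant of
    [Jordan lam h] consists of block diagonal matrices, the same description
    in each block gives [SSR_Jordan_blocks], and compactness follows from that
    of the group of all these [X] ([conj_orbit_compact]).

    For the differential part, a point [Z] of the orbit close to [J] is
    determined by the sum of its eigenspaces for positive eigenvalues, which is
    the graph of a matrix [k], the slope of [Z]; conversely
    [Z = W J W^-1] with [W = 1 + (k - k^T)], which is [orbit_param k].  That a
    symmetric [Z] has slope [k] reads [corner Z = k (head_mx Z)], and this is
    affine in the entries of [Z].  Hence
    [Z |-> (slope Z, the remaining entries of Z - orbit_param (slope Z))] is a
    rational chart of the space of symmetric matrices with an explicit rational
    inverse, and it straightens the orbit ([slice_chart]).  Translating it by
    the group gives charts around all the points, and restricting it to the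
    orbit gives the charts of the orbit ([orbit_chartP]).  The former are
    charts of [GLSym] near the orbit because [GLSym] is open in the space of symmetric matrices
    ([GLSym_open], a dimension count on positive and negative subspaces).

    The same charts serve on the homogeneous space as soon as [X |-> X J X^T]
    has smooth local sections.  The matrix [W] above is not orthogonal, but
    [W C^-T] is when [C C^T] is the Cholesky factorization of [W^T W]; the
    Cholesky factor is a smooth function of [k] and inherits the block pattern
    of [W^T W], so that it commutes with [J] and [W C^-T] still conjugates [J]
    to [orbit_param k] ([smooth_cholesky], [smooth_orbit_section]).

    All these maps have entries obtained from coordinates by sums, products,
    inverses of nonvanishing functions and square roots of positive functions,
    and the [C^k] functions are stable under these operations. *)

(** * Smooth functions with values in matrices *)

Section Ck.
Variables (R : realType) (V : normedModType R).

(** Differentiability is local; with [near_eq_derive] this is what makes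
    [Ck k U f] depend only on the values of [f] on the open set [U]. *)
Lemma near_eq_differentiable (W : normedModType R) (f g : V -> W) (x : V) :
  {near x, f =1 g} -> differentiable f x -> differentiable g x.
Proof.
move=> fg df; have fgx := nbhs_singleton fg.
have /diff_locallyP[dfc dfo] := df.
have e : g \o shift x = cst (g x) + 'd f x +o_0 id.
  apply/eqaddoP => e e0; move/eqaddoP: dfo => /(_ e e0) H.
  have fg0 : \forall y \near 0, f (y + x) = g (y + x).
    by have := fg; rewrite (near_shift 0)/=; apply: filterS => y; rewrite /= subr0.
  near=> y; have -> : g \o shift x = fun y => g (y + x) by [].
  have -> : (((fun y0 => g (y0 + x)) - (cst (g x) + 'd f x)) y) =
            ((f \o shift x - (cst (f x) + 'd f x)) y).
    by rewrite /= -[RHS]/(f (y + x) - (f x + 'd f x y)) (near fg0) // fgx.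
  by near: y.
have dg : 'd g x = 'd f x :> (V -> W) by exact: diff_unique.
by apply/diff_locallyP; rewrite dg.
Unshelve. all: by end_near. Qed.

Lemma Ck_ext (W : normedModType R) k (U : set V) (f g : V -> W) :
  open U -> {in U, f =1 g} -> Ck k U f -> Ck k U g.
Proof.
move=> oU; elim: k f g => [|k IH] f g fg /= => [fc|[fd fC]].
  have near_fg x : U x -> \forall y \near x, f y = g y.
    move=> Ux; apply: filterS (open_nbhs_nbhs (conj oU Ux)) => y /mem_set Uy.
    by rewrite fg.
  move=> x Ux; rewrite /prop_for /continuous_at -(fg x (mem_set Ux)).
  by apply: cvg_trans (fc x Ux); apply/near_eq_cvg; exact: near_fg.
have near_fg x : U x -> {near x, f =1 g}.
  move=> Ux; apply: filterS (open_nbhs_nbhs (conj oU Ux)) => y /mem_set Uy.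
  by rewrite fg.
split=> [x Ux|v]; first exact: near_eq_differentiable (near_fg x Ux) (fd x Ux).
apply: IH (fC v) => x /set_mem Ux; apply: near_eq_derive; exact: near_fg.
Qed.

Lemma CkW (W : normedModType R) k (U : set V) (f : V -> W) :
  Ck k.+1 U f -> Ck k U f.
Proof.
elim: k f => [|k IH] f /= [fd fC].
  by move=> x Ux; apply: differentiable_continuous; exact: fd.
by split=> // v; apply: IH; exact: fC.
Qed.

Lemma Ck_cst (W : normedModType R) k (U : set V) (w : W) : Ck k U (fun=> w).
Proof.
elim: k w => [|k IH] w /=; first by move=> x _; exact: cst_continuous.
split=> [x _|v]; first exact: differentiable_cst.
have -> : (fun x => 'D_v (fun=> w) x) = fun=> 0 :> W.
  by apply/funext => x; exact: derive_cst.
exact: IH.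
Qed.

Lemma CkD (W : normedModType R) k (U : set V) (f g : V -> W) :
  open U -> Ck k U f -> Ck k U g -> Ck k U (fun x => f x + g x).
Proof.
move=> oU; elim: k f g => [|k IH] f g /=.
  by move=> fc gc x Ux; apply: continuousD; [exact: fc | exact: gc].
move=> [fd fC] [gd gC]; split=> [x Ux|v].
  by apply: differentiableD; [exact: fd | exact: gd].
apply: Ck_ext (IH _ _ (fC v) (gC v)) => // x /set_mem Ux.
by rewrite [in RHS]deriveD //; apply: diff_derivable; [exact: fd | exact: gd].
Qed.

Lemma CkZl (W : normedModType R) k (U : set V) (f : V -> R) (w : W) :
  open U -> Ck k U f -> Ck k U (fun x => f x *: w).
Proof.
move=> oU; elim: k f => [|k IH] f /=.
  by move=> fc x Ux; apply: cvgZr_tmp; exact: fc.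
move=> [fd fC]; split=> [x Ux|v]; first by apply: differentiableZl; exact: fd.
apply: Ck_ext (IH _ (fC v)) => // x /set_mem Ux.
have dfx := fd x Ux.
by rewrite [RHS]deriveE ?diffZl // ?deriveE //; exact: differentiableZl.
Qed.

Lemma CkM k (U : set V) (f g : V -> R) :
  open U -> Ck k U f -> Ck k U g -> Ck k U (fun x => f x * g x).
Proof.
move=> oU; elim: k f g => [|k IH] f g.
  by move=> fc gc x Ux; apply: continuousM; [exact: fc | exact: gc].
move=> fK gK; have fk := CkW fK; have gk := CkW gK.
move: fK gK => [fd fC] [gd gC]; split=> [x Ux|v].
  by apply: differentiableM; [exact: fd | exact: gd].
apply: Ck_ext (CkD oU (IH _ _ fk (gC v)) (IH _ _ gk (fC v))) => // x /set_mem Ux.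
by rewrite [in RHS]deriveM //; apply: diff_derivable; [exact: fd | exact: gd].
Qed.

(** The derivative of [1 / f] is [- (1 / f)^2] times that of [f], so that the
    regularity of [1 / f] increases with that of [f]. *)
Lemma CkV k (U : set V) (f : V -> R) :
  open U -> (forall x, U x -> f x != 0) -> Ck k U f ->
  Ck k U (fun x => (f x)^-1).
Proof.
move=> oU f0; elim: k => [|k IH].
  by move=> fc x Ux; apply: continuousV; [exact: f0 | exact: fc].
move=> fK; have fk := IH (CkW fK); move: fK => [fd fC]; split=> [x Ux|v].
  by apply: differentiableV; [exact: fd | exact: f0].
have C1 := CkM oU (Ck_cst k U (-1 : R)) (CkM oU (CkM oU fk fk) (fC v)).
apply: Ck_ext C1 => // x /set_mem Ux.
rewrite [in RHS]deriveV ?f0 //; last by apply: diff_derivable; exact: fd.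
by rewrite /= expr2 invfM mulN1r scaleNr.
Qed.

(** As for the inverse: the derivative of [sqrt f] is that of [f] divided by
    [2 sqrt f]. *)
Lemma Ck_sqrt k (U : set V) (f : V -> R) :
  open U -> (forall x, U x -> 0 < f x) -> Ck k U f ->
  Ck k U (fun x => Num.sqrt (f x)).
Proof.
move=> oU f0; elim: k => [|k IH].
  by move=> fc x Ux; apply: continuous_comp; [exact: fc | exact: sqrt_continuous].
move=> fK; have fk := IH (CkW fK); move: fK => [fd fC].
have sd x : U x -> differentiable (Num.sqrt : R -> R) (f x).
  by move=> Ux; apply/derivable1_diffP; have [] := is_derive1_sqrt (f0 _ Ux).
split=> [x Ux|v].
  by apply: differentiable_comp; [exact: fd | exact: sd].
have sN0 x : U x -> 2 * Num.sqrt (f x) != 0.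
  by move=> Ux; rewrite mulf_neq0 ?pnatr_eq0 // sqrtr_eq0 -ltNge f0.
have C1 := CkM oU (CkV oU sN0 (CkM oU (Ck_cst k U (2 : R)) fk)) (fC v).
apply: Ck_ext C1 => // x /set_mem Ux.
have dfx := fd x Ux; have dsx := sd x Ux.
rewrite [RHS]deriveE; last exact: differentiable_comp.
rewrite (@diff_comp _ _ _ _ f Num.sqrt) //=.
rewrite (_ : 'd Num.sqrt (f x) = *:%R^~ (Num.sqrt^`()%classic (f x)) :> (R -> R)); last first.
  exact: diff1E.
rewrite derive1E; have [_ ->] := is_derive1_sqrt (f0 _ Ux).
by rewrite -deriveE // mulrC.
Qed.

End Ck.

Section MatrixSmooth.
Variables (R : realType) (V : normedModType R).
Implicit Types U : set V.

Lemma smooth_ext (W : normedModType R) U (f g : V -> W) :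
  open U -> {in U, f =1 g} -> smooth U f -> smooth U g.
Proof. by move=> oU fg fs k; exact: Ck_ext (fs k). Qed.

Lemma Ck_sub (W : normedModType R) k U U' (f : V -> W) :
  U' `<=` U -> Ck k U f -> Ck k U' f.
Proof.
move=> sU; elim: k f => [|k IH] f /=; first by move=> fc x /sU; exact: fc.
by move=> [fd fC]; split=> [x /sU|v]; [exact: fd | exact: IH (fC v)].
Qed.

Lemma smooth_sum (W : normedModType R) U (I : Type) (r : seq I) (P : pred I)
    (f : I -> V -> W) : open U ->
  (forall i, P i -> smooth U (f i)) -> smooth U (fun x => \sum_(i <- r | P i) f i x).
Proof.
move=> oU fs; elim: r => [|i r IH].
  by move=> k; apply: Ck_ext (Ck_cst k U (0 : W)) => // x _; rewrite big_nil.
case Pi: (P i).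
  move=> k; apply: Ck_ext (CkD oU (fs i Pi k) (IH k)) => // x _.
  by rewrite big_cons Pi.
by move=> k; apply: Ck_ext (IH k) => // x _; rewrite big_cons Pi.
Qed.

Lemma smooth_prod U (I : Type) (r : seq I) (P : pred I) (f : I -> V -> R) :
  open U -> (forall i, P i -> smooth U (f i)) ->
  smooth U (fun x => \prod_(i <- r | P i) f i x).
Proof.
move=> oU fs; elim: r => [|i r IH].
  by move=> k; apply: Ck_ext (Ck_cst k U (1 : R)) => // x _; rewrite big_nil.
case Pi: (P i).
  move=> k; apply: Ck_ext (CkM oU (fs i Pi k) (IH k)) => // x _.
  by rewrite big_cons Pi.
by move=> k; apply: Ck_ext (IH k) => // x _; rewrite big_cons Pi.
Qed.

Definition entry_smooth U m n (F : V -> 'M[R]_(m, n)) :=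
  forall i j, smooth U (fun x => F x i j).

Lemma entry_smooth_smooth U m n (F : V -> 'M[R]_(m, n)) :
  open U -> entry_smooth U F -> smooth U F.
Proof.
move=> oU FU.
have H : smooth U (fun x => \sum_i \sum_j F x i j *: delta_mx i j).
  apply: smooth_sum => // i _; apply: smooth_sum => // j _ k.
  by apply: CkZl => //; exact: FU.
by apply: smooth_ext H => // x _; rewrite -matrix_sum_delta.
Qed.

Lemma entry_smooth_sub U U' m n (F : V -> 'M[R]_(m, n)) :
  U' `<=` U -> entry_smooth U F -> entry_smooth U' F.
Proof. by move=> sU FU i j k; exact: Ck_sub (FU i j k). Qed.

Lemma entry_smooth_cst U m n (A : 'M[R]_(m, n)) : entry_smooth U (fun=> A).
Proof. by move=> i j k; exact: Ck_cst. Qed.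

Lemma entry_smoothD U m n (F G : V -> 'M[R]_(m, n)) : open U ->
  entry_smooth U F -> entry_smooth U G -> entry_smooth U (fun x => F x + G x).
Proof.
move=> oU FU GU i j k; apply: Ck_ext (CkD oU (FU i j k) (GU i j k)) => // x _.
by rewrite mxE.
Qed.

Lemma entry_smoothM U m n p (F : V -> 'M[R]_(m, n)) (G : V -> 'M[R]_(n, p)) :
  open U -> entry_smooth U F -> entry_smooth U G ->
  entry_smooth U (fun x => F x *m G x).
Proof.
move=> oU FU GU i j.
have H : smooth U (fun x => \sum_l F x i l * G x l j).
  by apply: smooth_sum => // l _ k; apply: CkM => //; [exact: FU|exact: GU].
by apply: smooth_ext H => // x _; rewrite mxE.
Qed.

Lemma entry_smoothN U m n (F : V -> 'M[R]_(m, n)) : open U ->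
  entry_smooth U F -> entry_smooth U (fun x => - F x).
Proof.
move=> oU FU i j k; apply: Ck_ext (CkM oU (Ck_cst k U (-1 : R)) (FU i j k)) => //.
by move=> x _; rewrite mxE mulN1r.
Qed.

Lemma entry_smoothB U m n (F G : V -> 'M[R]_(m, n)) : open U ->
  entry_smooth U F -> entry_smooth U G -> entry_smooth U (fun x => F x - G x).
Proof.
by move=> oU FU GU; apply: entry_smoothD => //; exact: entry_smoothN.
Qed.

Lemma entry_smooth_tr U m n (F : V -> 'M[R]_(m, n)) : open U ->
  entry_smooth U F -> entry_smooth U (fun x => (F x)^T).
Proof.
by move=> oU FU i j; apply: smooth_ext (FU j i) => // x _; rewrite mxE.
Qed.

Lemma entry_smooth_lin U m n p q (L : {linear 'M[R]_(m, n) -> 'M[R]_(p, q)})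
    (F : V -> 'M[R]_(m, n)) : open U ->
  entry_smooth U F -> entry_smooth U (fun x => L (F x)).
Proof.
move=> oU FU k l.
have H : smooth U (fun x => \sum_i \sum_j F x i j * L (delta_mx i j) k l).
  apply: smooth_sum => // i _; apply: smooth_sum => // j _ e.
  by apply: CkM => //; [exact: FU|exact: Ck_cst].
apply: smooth_ext H => // x _; rewrite {2}[F x]matrix_sum_delta.
rewrite linear_sum summxE; apply: eq_bigr => i _.
by rewrite linear_sum summxE; apply: eq_bigr => j _; rewrite linearZ mxE.
Qed.

Lemma entry_smooth_row_mx U m n p (F : V -> 'M[R]_(m, n))
    (G : V -> 'M[R]_(m, p)) : open U ->
  entry_smooth U F -> entry_smooth U G ->
  entry_smooth U (fun x => row_mx (F x) (G x)).
Proof.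
move=> oU FU GU i j; case: (split_ordP j) => l ->.
  by apply: smooth_ext (FU i l) => // x _; rewrite row_mxEl.
by apply: smooth_ext (GU i l) => // x _; rewrite row_mxEr.
Qed.

Lemma smooth_det U n (F : V -> 'M[R]_n) : open U ->
  entry_smooth U F -> smooth U (fun x => \det (F x)).
Proof.
move=> oU FU; apply: smooth_sum => // s _ k; apply: CkM => //; first exact: Ck_cst.
by apply: smooth_prod => // i _; exact: FU.
Qed.

(** Cramer's formula expresses the entries of the inverse by determinants. *)
Lemma entry_smooth_inv U n (F : V -> 'M[R]_n) : open U ->
  (forall x, U x -> F x \in unitmx) ->
  entry_smooth U F -> entry_smooth U (fun x => invmx (F x)).
Proof.
move=> oU Fu FU i j.
have H : smooth U (fun x => (\det (F x))^-1 *
    ((-1) ^+ (j + i) * \det (row' j (col' i (F x))))).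
  move=> k; apply: CkM => //.
    apply: CkV => //; last exact: smooth_det.
    by move=> x Ux; rewrite -unitfE -unitmxE Fu.
  apply: CkM => //; first exact: Ck_cst.
  apply: smooth_det => // a b.
  by apply: smooth_ext (FU (lift j a) (lift i b)) => // x _; rewrite !mxE.
apply: smooth_ext H => // x /set_mem Ux.
by rewrite /invmx Fu // !mxE.
Qed.

Lemma entry_smooth_continuous U m n (F : V -> 'M[R]_(m, n)) x : open U ->
  entry_smooth U F -> U x -> {for x, continuous F}.
Proof. by move=> oU FU Ux; exact: (entry_smooth_smooth oU FU 0). Qed.

End MatrixSmooth.

Lemma entry_smooth_id (R : realType) m n (U : set 'M[R]_(m, n)) :
  open U -> entry_smooth U id.
Proof.
move=> oU i j [|k] /=; first by move=> x _; exact: coord_continuous.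
split=> [x _|v]; first exact: differentiable_coord.
apply: Ck_ext (Ck_cst k U (v i j : R)) => // x _.
rewrite deriveE; last exact: differentiable_coord.
pose L := (fun N : 'M[R]_(m, n) => N i j : R).
have Llin : linear L by move=> a A B; rewrite /L !mxE.
pose LH := GRing.isLinear.Build _ _ _ _ L Llin.
pose LL : {linear 'M[R]_(m, n) -> R} := HB.pack L LH.
have -> : (fun x0 : 'M[R]_(m, n) => x0 i j) = LL by [].
by rewrite diff_lin //; exact: coord_continuous.
Qed.

(** * Smooth Cholesky factorization *)

Section Cholesky.
Variables (R : realType) (V : normedModType R).

(** The Schur complement is the Gram matrix of the quadratic form on the
    orthogonal complement, for this form, of the first basis vector. *)
Lemma posdef_block n (P : 'M[R]_(1 + n)) : P^T = P -> posdef P ->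
  let b := dlsubmx P in
  0 < P 0 0 /\ posdef (drsubmx P - (P 0 0)^-1 *: (b *m b^T)).
Proof.
move=> Psym Ppos b; set al : R := P 0 0.
have Pul : ulsubmx P = al%:M.
  by rewrite [LHS]mx11_scalar !mxE; congr (P _ _)%:M; apply/val_inj.
have Pur : ursubmx P = b^T by rewrite /b trmx_dlsub Psym.
have PE : P = block_mx al%:M b^T b (drsubmx P).
  by rewrite -[LHS]submxK Pul Pur.
have al0 : 0 < al.
  pose e : 'cV[R]_(1 + n) := delta_mx 0 0.
  have e0 : e != 0.
    by apply/eqP => /matrixP/(_ 0 0); rewrite !mxE eqxx => /eqP; rewrite oner_eq0.
  have := Ppos e e0.
  by rewrite /e trmx_delta -mulmxA -colE -rowE !mxE.
split=> // x x0.
(* y is the vector with last coordinates x that is orthogonal to the first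
   basis vector for the form P. *)
pose y : 'cV[R]_(1 + n) := col_mx (- (al^-1 *: (b^T *m x))) x.
have y0 : y != 0.
  apply: contra x0 => /eqP/(congr1 dsubmx); rewrite col_mxKd => ->.
  by rewrite linear0.
suff <- : y^T *m P *m y = x^T *m (drsubmx P - al^-1 *: (b *m b^T)) *m x.
  exact: Ppos.
rewrite -mulmxA PE /y mul_block_col tr_col_mx mul_row_col.
rewrite mul_scalar_mx scalerN scalerA mulfV ?gt_eqF // scale1r addNr mulmx0 add0r.
by rewrite -[RHS]mulmxA mulmxBl mulmxN addrC -scalemxAr -scalemxAl mulmxA block_mxKdr.
Qed.

(** Recursion on the size: the first column of the factor is that of [P]
    divided by the square root of its first entry, and the rest is the factor
    of the Schur complement.  The labels [a] of the indices record a block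
    pattern: each step preserves the vanishing of the entries whose row and
    column have different labels, since the entry [(i, j)] of [b b^T] can be
    nonzero only if [i] and [j] both have the label of the first index. *)
Lemma smooth_cholesky n (U : set V) (a : 'I_n -> R) (P : V -> 'M[R]_n) :
  open U -> entry_smooth U P ->
  (forall x, U x -> (P x)^T = P x /\ posdef (P x)) ->
  (forall x, U x -> forall i j, a i != a j -> P x i j = 0) ->
  exists C : V -> 'M[R]_n, entry_smooth U C /\
    forall x, U x -> C x *m (C x)^T = P x /\
      (forall i j, a i != a j -> C x i j = 0).
Proof.
move=> oU; elim: n a P => [|n IH] a P sP Ppos Pa.
  exists P; split=> // x Ux; split; last exact: Pa.
  by rewrite [LHS]flatmx0 [RHS]flatmx0.
pose al x := P x 0 0; pose b x : 'cV[R]_n := dlsubmx (P x : 'M[R]_(1 + n)).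
pose D x : 'M[R]_n := drsubmx (P x : 'M[R]_(1 + n)).
pose P' x := D x - (al x)^-1 *: (b x *m (b x)^T).
have bE x i : b x i 0 = P x (lift 0 i) 0.
  by rewrite !mxE; congr (P _ _ _); apply/val_inj.
have DE x i j : D x i j = P x (lift 0 i) (lift 0 j).
  by rewrite !mxE; congr (P _ _ _); apply/val_inj.
have al_gt0 x : U x -> 0 < al x.
  by move=> Ux; have [s p] := Ppos x Ux; have [] := posdef_block s p.
have sal : smooth U al by exact: sP.
have sb : entry_smooth U b.
  by move=> i j; apply: smooth_ext (sP (lift 0 i) 0) => // x _; rewrite ord1 bE.
have salV : smooth U (fun x => (al x)^-1).
  by move=> k; apply: CkV => // x /al_gt0/lt0r_neq0.
have sP' : entry_smooth U P'.
  apply: entry_smoothB => //.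
    by move=> i j; apply: smooth_ext (sP (lift 0 i) (lift 0 j)) => // x _; rewrite DE.
  have sbb := entry_smoothM oU sb (entry_smooth_tr oU sb).
  move=> i j k; apply: Ck_ext (CkM oU (salV k) (sbb i j k)) => // x _.
  by rewrite [RHS]mxE.
have [x Ux|x Ux i j aij|C' [sC' C'P]] := IH (fun i => a (lift 0 i)) P' sP'.
- have [s p] := Ppos x Ux; have [_ ?] := posdef_block s p; split=> //.
  rewrite /P' linearB linearZ /= trmx_mul trmxK /D.
  by rewrite trmx_drsub s.
- rewrite /P' [LHS]mxE DE (Pa x Ux _ _ aij) add0r 3!mxE big_ord1 [X in _ * (_ * X)]mxE !bE.
  have [ai0|ai0] := eqVneq (a (lift 0 i)) (a 0).
    rewrite (Pa x Ux (lift 0 j) 0) ?mulr0 ?oppr0 //.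
    by rewrite eq_sym -ai0.
  by rewrite (Pa x Ux _ _ ai0) mul0r mulr0 oppr0.
pose s x := Num.sqrt (al x).
have s_gt0 x : U x -> 0 < s x by move=> /al_gt0; rewrite sqrtr_gt0.
have ss : smooth U s by move=> k; exact: Ck_sqrt.
have ssV : smooth U (fun x => (s x)^-1).
  by move=> k; apply: CkV => // x /s_gt0/lt0r_neq0.
pose C x : 'M[R]_n.+1 := block_mx (s x)%:M 0 ((s x)^-1 *: b x) (C' x).
have l0 : lshift n (0 : 'I_1) = 0 :> 'I_n.+1 by exact/val_inj.
have lS (i : 'I_n) : rshift 1 i = lift 0 i :> 'I_n.+1 by exact/val_inj.
have C00 x : C x 0 0 = s x.
  by have := block_mxEul (s x)%:M 0 ((s x)^-1 *: b x) (C' x) 0 0; rewrite l0 [RHS]mxE.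
have C0S x i : C x 0 (lift 0 i) = 0.
  by have := block_mxEur (s x)%:M 0 ((s x)^-1 *: b x) (C' x) 0 i; rewrite l0 lS [RHS]mxE.
have CS0 x i : C x (lift 0 i) 0 = (s x)^-1 * b x i 0.
  by have := block_mxEdl (s x)%:M 0 ((s x)^-1 *: b x) (C' x) i 0; rewrite l0 lS [RHS]mxE.
have CSS x i j : C x (lift 0 i) (lift 0 j) = C' x i j.
  by have := block_mxEdr (s x)%:M 0 ((s x)^-1 *: b x) (C' x) i j; rewrite !lS.
exists C; split=> [i j|x Ux].
  case: (unliftP 0 i) => [i'|] ->; case: (unliftP 0 j) => [j'|] ->.
  - by apply: smooth_ext (sC' i' j') => // x _; rewrite CSS.
  - by move=> k; apply: Ck_ext (CkM oU (ssV k) (sb i' 0 k)) => // x _; rewrite CS0.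
  - by apply: smooth_ext (fun k => Ck_cst k U (0 : R)) => // x _; rewrite C0S.
  - by apply: smooth_ext ss => // x _; rewrite C00.
have [sym pd] := Ppos x Ux; have [CP Ca] := C'P x Ux; have s0 := s_gt0 x Ux.
have s2 : s x * s x = al x by rewrite -expr2 sqr_sqrtr // ltW // al_gt0.
split.
  pose B : 'M[R]_(1 + n) := block_mx (s x)%:M 0 ((s x)^-1 *: b x) (C' x).
  suff : B *m B^T = P x by [].
  rewrite /B tr_block_mx mulmx_block trmx0 tr_scalar_mx !mul0mx !mulmx0 !addr0.
  rewrite CP -[RHS](@submxK _ 1 n 1 n); congr block_mx.
  - by rewrite -scalar_mxM s2 [RHS]mx11_scalar !mxE; congr (P _ _ _)%:M; apply/val_inj.
  - rewrite linearZ /= mul_scalar_mx scalerA divff ?gt_eqF // scale1r.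
    by rewrite /b trmx_dlsub sym.
  - by rewrite -scalemxAl mul_mx_scalar scalerA mulVf ?gt_eqF // scale1r.
  - rewrite linearZ /= -scalemxAl -scalemxAr scalerA -invfM s2 /P' addrC subrK //.
move=> i j; case: (unliftP 0 i) => [i'|] ->; case: (unliftP 0 j) => [j'|] -> aij.
- by rewrite CSS Ca.
- by rewrite CS0 bE (Pa x Ux _ _ aij) mulr0.
- by rewrite C0S.
- by rewrite eqxx in aij.
Qed.

End Cholesky.

(** * The spectral theorem for real symmetric matrices *)

Section Spectral.
Variable R : realType.

Lemma orthoE n (X : 'M[R]_n) : orthogonal_group n X -> X^T *m X = 1%:M.
Proof. exact: mulmx1C. Qed.

Lemma ortho_unit n (X : 'M[R]_n) : orthogonal_group n X -> X \in unitmx.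
Proof. by move=> /mulmx1_unit[]. Qed.

Lemma orthoM n (X Y : 'M[R]_n) :
  orthogonal_group n X -> orthogonal_group n Y -> orthogonal_group n (X *m Y).
Proof.
move=> XX YY; rewrite /orthogonal_group /= trmx_mul mulmxA -(mulmxA X).
by rewrite [Y *m _]YY mulmx1; exact: XX.
Qed.

Lemma orthoT n (X : 'M[R]_n) : orthogonal_group n X -> orthogonal_group n X^T.
Proof. by move=> XX; rewrite /orthogonal_group /= trmxK; exact: orthoE. Qed.

Lemma sqnorm_ge0 n (v : 'cV[R]_n) : 0 <= (v^T *m v) 0 0.
Proof. by rewrite mxE sumr_ge0 // => i _; rewrite mxE -expr2 sqr_ge0. Qed.

Lemma sqnorm_gt0 n (v : 'cV[R]_n) : v != 0 -> 0 < (v^T *m v) 0 0.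
Proof.
move=> v0; rewrite lt_def sqnorm_ge0 andbT; apply: contra v0.
rewrite mxE psumr_eq0 => [/allP v0|i _]; last by rewrite mxE -expr2 sqr_ge0.
apply/eqP/matrixP => i j; rewrite ord1 [RHS]mxE; apply/eqP.
by have := v0 i (mem_index_enum i); rewrite mxE -expr2 sqrf_eq0.
Qed.

(** A complex eigenvalue [x + i y] exists.  With [a + i b] an eigenvector, the
    symmetry of [A] yields [y (|a|^2 + |b|^2) = 0], so that the eigenvalue is
    real and [a] or [b] is a real eigenvector. *)
Lemma symmetric_eigenvector n (A : 'M[R]_n.+1) : A^T = A ->
  exists x (v : 'cV[R]_n.+1), v != 0 /\ A *m v = x *: v.
Proof.
move=> As; pose C : closedFieldType := complex.complex R.
pose AC : 'M[C]_n.+1 := map_mx (complex.real_complex R) A.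
have [z rz] : exists z, root (char_poly AC) z.
  by apply/closed_rootP; rewrite size_char_poly.
have /eigenvalueP[w wA w0] : eigenvalue AC z.
  by rewrite eigenvalue_root_char.
pose a := map_mx (@complex.Re R) w; pose b := map_mx (@complex.Im R) w.
pose x := complex.Re z; pose y := complex.Im z.
have aA : a *m A = x *: a - y *: b.
  apply/matrixP => i j; have /matrixP/(_ i j)/(congr1 (@complex.Re R)) := wA.
  rewrite !mxE raddf_sum /= => E; transitivity (complex.Re (z * w i j)).
    rewrite -E; apply: eq_bigr => k _; rewrite !mxE.
    by case: (w i k) => p q /=; rewrite mulr0 subr0.
  by rewrite /x /y; case: (z) (w i j) => p q [p' q'].
have bA : b *m A = x *: b + y *: a.
  apply/matrixP => i j; have /matrixP/(_ i j)/(congr1 (@complex.Im R)) := wA.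
  rewrite !mxE raddf_sum /= => E; transitivity (complex.Im (z * w i j)).
    rewrite -E; apply: eq_bigr => k _; rewrite !mxE.
    by case: (w i k) => p q /=; rewrite mulr0 add0r.
  by rewrite /x /y; case: (z) (w i j) => p q [p' q'].
have ab0 : a != 0 \/ b != 0.
  have [a0|] := eqVneq a 0; last by left.
  right; apply: contra w0 => /eqP b0; apply/eqP/matrixP => i j.
  move/matrixP/(_ i j): a0; move/matrixP/(_ i j): b0; rewrite !mxE.
  by case: (w i j) => p q /= -> ->.
have nab : 0 < (a *m a^T) 0 0 + (b *m b^T) 0 0.
  have := sqnorm_ge0 a^T; have := sqnorm_ge0 b^T; rewrite !trmxK => gb ga.
  case: ab0 => [a0|b0].
    have := @sqnorm_gt0 _ a^T; rewrite !trmxK trmx_eq0 => /(_ a0) h.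
    exact: ltr_wpDr.
  have := @sqnorm_gt0 _ b^T; rewrite !trmxK trmx_eq0 => /(_ b0) h.
  exact: ltr_wpDl.
have y0 : y = 0.
  have tr11 (u : 'M[R]_1) : u^T 0 0 = u 0 0 by rewrite mxE.
  have E1 : (a *m A *m b^T) 0 0 = (b *m A *m a^T) 0 0.
    by rewrite -[LHS]tr11 !trmx_mul trmxK As mulmxA.
  have E2 : (a *m b^T) 0 0 = (b *m a^T) 0 0.
    by rewrite -[LHS]tr11 trmx_mul trmxK.
  have entry (u v : 'rV[R]_n.+1) c e : ((c *: u + e *: v) *m a^T) 0 0 = 
      c * (u *m a^T) 0 0 + e * (v *m a^T) 0 0.
    by rewrite mulmxDl -!scalemxAl mxE [in X in X + _]mxE [in X in _ + X]mxE.
  move: E1; rewrite aA bA entry mulmxBl -!scalemxAl.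
  rewrite [LHS]mxE [in X in X + _]mxE [in X in _ + X]mxE [in X in _ + X]mxE E2.
  move=> E; apply/eqP; have : y * ((a *m a^T) 0 0 + (b *m b^T) 0 0) = 0 by lra.
  by move/eqP; rewrite mulf_eq0 (gt_eqF nab) orbF.
have trA (u : 'rV[R]_n.+1) : u *m A = x *: u -> A *m u^T = x *: u^T.
  by move=> /(congr1 trmx); rewrite trmx_mul As linearZ.
case: ab0 => [a0|b0]; exists x.
  exists a^T; rewrite trmx_eq0; split=> //; apply: trA.
  by rewrite aA y0 scale0r subr0.
exists b^T; rewrite trmx_eq0; split=> //; apply: trA.
by rewrite bA y0 scale0r addr0.
Qed.

(** The Householder reflection that exchanges [v] and the first basis vector, or the
    identity if they are equal. *)
Lemma ortho_with_col0 n (v : 'cV[R]_n.+1) : v^T *m v = 1%:M ->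
  exists2 X : 'M[R]_n.+1, orthogonal_group _ X & X *m delta_mx 0 0 = v.
Proof.
move=> v1; pose e : 'cV[R]_n.+1 := delta_mx 0 0; pose w := v - e.
have [w0|w0] := eqVneq w 0.
  exists 1%:M; first by rewrite /orthogonal_group /= trmx1 mulmx1.
  by rewrite mul1mx; apply/esym/eqP; rewrite -subr_eq0; apply/eqP.
pose c := (w^T *m w) 0 0; have c0 : 0 < c by exact: sqnorm_gt0.
have ww : w^T *m w = c%:M by exact: mx11_scalar.
have ee : e^T *m e = 1%:M.
  by rewrite /e trmx_delta mul_delta_mx [RHS]mx11_scalar; apply/matrixP => i j; rewrite !ord1 !mxE.
have ev : e^T *m v = v^T *m e.
  by rewrite -[LHS]trmxK trmx_mul trmxK [v^T *m e]mx11_scalar tr_scalar_mx.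
have wT : w^T = v^T - e^T by rewrite /w linearB.
pose t := (v^T *m e) 0 0; have ve : v^T *m e = t%:M by exact: mx11_scalar.
have cE : c = 2 - 2 * t.
  rewrite /c wT /w mulmxBr !mulmxBl ee v1 ev ve -!raddfB /= mxE eqxx mulr1n.
  lra.
have we : w^T *m e = (- c / 2)%:M.
  by rewrite wT mulmxBl ee ve -raddfB cE /=; congr _%:M; lra.
pose X : 'M[R]_n.+1 := 1%:M - (2 / c) *: (w *m w^T).
have XT : X^T = X by rewrite /X linearB linearZ /= trmx1 trmx_mul trmxK.
exists X.
  pose N := w *m w^T; pose k := 2 / c.
  have NN : N *m N = c *: N.
    by rewrite /N mulmxA -(mulmxA w) ww mul_mx_scalar scalemxAl.
  have kk : k * (k * c) = k + k by rewrite /k; field; rewrite gt_eqF.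
  rewrite /orthogonal_group /= XT /X -/N -/k mulmxBl mul1mx mulmxBr mulmx1.
  rewrite -scalemxAr -scalemxAl NN !scalerA -mulrA kk scalerDl.
  by rewrite opprB addrK subrK.
rewrite /X mulmxBl mul1mx -scalemxAl -mulmxA we mul_mx_scalar scalerA.
rewrite (_ : 2 / c * (- c / 2) = -1); last by field; rewrite gt_eqF.
by rewrite scaleN1r opprK /w addrC subrK.
Qed.

(** Completing a unit eigenvector to an orthogonal matrix splits off a block of
    size 1; symmetry kills both off-diagonal blocks. *)
Lemma real_spectral n (A : 'M[R]_n) : A^T = A ->
  exists X (d : 'rV[R]_n), orthogonal_group n X /\ A = X *m diag_mx d *m X^T.
Proof.
elim: n A => [|n IH] A As.
  exists 1%:M, 0; split; first by rewrite /orthogonal_group /= trmx1 mulmx1.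
  by rewrite [LHS]flatmx0 [RHS]flatmx0.
have [x [v [v0 Av]]] := symmetric_eigenvector As.
pose r := Num.sqrt ((v^T *m v) 0 0).
have r0 : 0 < r by rewrite sqrtr_gt0 sqnorm_gt0.
pose w := r^-1 *: v.
have w1 : w^T *m w = 1%:M.
  have -> : w^T = r^-1 *: v^T by rewrite /w linearZ.
  rewrite /w -scalemxAl -scalemxAr scalerA [v^T *m v]mx11_scalar.
  rewrite -(@sqr_sqrtr _ ((v^T *m v) 0 0)) ?sqnorm_ge0 // -/r scale_scalar_mx.
  by rewrite -invfM -expr2 mulVf // expf_neq0 // gt_eqF.
have Aw : A *m w = x *: w by rewrite -scalemxAr Av !scalerA mulrC.
have [X0 X0o X0e] := ortho_with_col0 w1.
pose B0 : 'M[R]_n.+1 := X0^T *m A *m X0.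
have B0T : B0^T = B0 by rewrite /B0 !trmx_mul trmxK As mulmxA.
have Be : B0 *m delta_mx 0 0 = x *: (delta_mx 0 0 : 'cV_n.+1).
  rewrite /B0 -mulmxA X0e -mulmxA Aw -scalemxAr -X0e mulmxA orthoE //.
  by rewrite mul1mx.
have Bi0 i : B0 i 0 = x *+ (i == 0).
  move/matrixP/(_ i 0): Be; rewrite -colE !mxE => ->.
  by rewrite eqxx andbT mulr_natr.
pose B : 'M[R]_(1 + n) := B0; have BT : B^T = B by exact: B0T.
have l0 i : lshift n (i : 'I_1) = 0 :> 'I_n.+1 by rewrite ord1; exact/val_inj.
have Bul : ulsubmx B = x%:M.
  by apply/matrixP => i j; rewrite 2!mxE !l0 [LHS]Bi0 !ord1 mxE.
have Bdl : dlsubmx B = 0.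
  by apply/matrixP => i j; rewrite 2!mxE !l0 [LHS]Bi0 mxE.
have Bur : ursubmx B = 0 by rewrite -[B]BT -trmx_dlsub Bdl trmx0.
have Bdr : (drsubmx B)^T = drsubmx B by rewrite trmx_drsub BT.
have [X' [d' [X'o DE]]] := IH _ Bdr.
pose Y : 'M[R]_(1 + n) := block_mx 1%:M 0 0 X'.
have Yo : orthogonal_group (1 + n) Y.
  rewrite /orthogonal_group /= /Y tr_block_mx mulmx_block !trmx0 trmx1.
  rewrite !mulmx0 !mul0mx !mulmx1 !addr0 !add0r [X' *m _]X'o.
  by rewrite -scalar_mx_block.
have BE : B = Y *m diag_mx (row_mx x%:M d') *m Y^T.
  rewrite diag_mx_row /Y tr_block_mx !mulmx_block !trmx0 trmx1.
  rewrite !mulmx0 !mul0mx !mulmx1 !mul1mx !addr0 !add0r -DE.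
  rewrite -[LHS]submxK Bul Bur Bdl; congr block_mx.
  - by apply/matrixP => i j; rewrite !ord1 !mxE eqxx.
  - by rewrite mul0mx.
have AE : A = X0 *m B *m X0^T.
  by rewrite /B /B0 !mulmxA [X0 *m _]X0o mul1mx -mulmxA [X0 *m _]X0o mulmx1.
pose Z : 'M[R]_n.+1 := X0 *m Y.
pose d : 'rV[R]_n.+1 := row_mx (x%:M : 'M[R]_1) d'.
exists Z, d; split; first exact: (@orthoM (1 + n)).
by rewrite AE BE (@trmx_mul _ (1 + n) (1 + n) (1 + n)) !mulmxA.
Qed.

End Spectral.

(** * Characteristic polynomials and inertia *)

Section Inertia.
Variable R : realType.

Lemma char_poly_conj n (X A : 'M[R]_n) : orthogonal_group n X ->
  char_poly (X *m A *m X^T) = char_poly A.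
Proof.
move=> Xo; rewrite /char_poly.
have XX : map_mx polyC X *m map_mx polyC X^T = 1%:M by rewrite -map_mxM Xo map_mx1.
have -> : char_poly_mx (X *m A *m X^T) =
    map_mx polyC X *m char_poly_mx A *m map_mx polyC X^T.
  rewrite /char_poly_mx !map_mxM mulmxBr mulmxBl mul_mx_scalar -scalemxAl XX.
  by rewrite scalemx1.
by rewrite !det_mulmx mulrAC -det_mulmx XX det1 mul1r.
Qed.

Lemma char_poly_diag n (d : 'rV[R]_n) :
  char_poly (diag_mx d) = \prod_(x <- [tuple d 0 i | i < n]) ('X - x%:P).
Proof.
rewrite char_poly_trig ?diag_mx_is_trig // big_tuple.
by apply: eq_bigr => i _; rewrite tnth_mktuple mxE eqxx.
Qed.

(** The spectral theorem gives some diagonal form; its entries are the roots of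
    the characteristic polynomial, hence a permutation of the entries of [d],
    and the permutation matrix is orthogonal. *)
Lemma symmetric_conj_diag n (A : 'M[R]_n) (d : 'rV[R]_n) : A^T = A ->
  char_poly A = char_poly (diag_mx d) ->
  exists2 X, orthogonal_group n X & A = X *m diag_mx d *m X^T.
Proof.
move=> /real_spectral[X [e [Xo AE]]].
rewrite AE char_poly_conj // !char_poly_diag => /prod_XsubC_eq/tuple_permP[s es].
have {es} es i : e 0 i = d 0 (s i).
  have /(congr1 (fun t => nth 0 t i)) := es.
  by rewrite -!tnth_nth !tnth_mktuple.
exists (X *m perm_mx s).
  apply: orthoM => //; rewrite /orthogonal_group /= tr_perm_mx -perm_mxM.
  by rewrite mulgV perm_mx1.
rewrite trmx_mul !mulmxA -!(mulmxA X); congr (X *m (_ *m _)).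
apply/matrixP => i j; rewrite tr_perm_mx -col_permE -row_permE !mxE.
by rewrite es (inj_eq perm_inj).
Qed.

Definition pos_set n (d : 'rV[R]_n) : {set 'I_n} := [set i | 0 < d 0 i]%SET.

Lemma count_row n (d : 'rV[R]_n) (P : pred R) :
  count P [tuple d 0 i | i < n] = #|[set i | P (d 0 i)]%SET|.
Proof.
rewrite /= count_map cardsE cardE [in RHS]/enum_mem size_filter -enumT.
by apply: eq_count => i.
Qed.

(** The number of negative entries is then [n - q] because none is zero. *)
Lemma GLSymP n q (A : 'M[R]_n) : GLSym n q A <->
  exists X (d : 'rV[R]_n), [/\ orthogonal_group n X, A = X *m diag_mx d *m X^T,
    (forall i, d 0 i != 0) & #|pos_set d| = q].
Proof.
split=> [[Au As [s [Es sp sn]]]|[X [d [Xo -> d0 dq]]]].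
  have [X [d [Xo AE]]] := real_spectral As.
  have ps : perm_eq s [tuple d 0 i | i < n].
    by apply: prod_XsubC_eq; rewrite -Es AE char_poly_conj // char_poly_diag.
  exists X, d; split=> // [i|].
    move: Au; rewrite AE !unitmx_mul => /andP[/andP[_]].
    rewrite unitmxE unitfE det_diag prodf_seq_neq0 => /allP/(_ i).
    by rewrite mem_index_enum => /(_ isT).
  by rewrite -sp (seq.permP ps) count_row.
split.
- rewrite !unitmx_mul unitmx_tr ortho_unit // andbT /=.
  by rewrite unitmxE unitfE det_diag; apply/prodf_neq0.
- by rewrite !trmx_mul trmxK tr_diag_mx mulmxA.
exists [tuple d 0 i | i < n]; split.
- by rewrite char_poly_conj // char_poly_diag.
- by rewrite count_row.
rewrite count_row -dq cardsCs card_ord; congr (n - _)%N; apply: eq_card => i.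
by rewrite !inE; have := d0 i; case: ltrgt0P.
Qed.

(** A linear system with more unknowns than equations: the unknowns are the
    coordinates of [y] in [P] and the equations are indexed by [Q]. *)
Lemma vector_in_both n (K : 'M[R]_n) (P Q : {set 'I_n}) : (#|Q| < #|P|)%N ->
  exists y : 'rV[R]_n, [/\ y != 0, (forall i, i \notin P -> y 0 i = 0) &
    forall j, j \in Q -> (y *m K) 0 j = 0].
Proof.
move=> QP; pose f (i : 'I_#|P|) : 'I_n := enum_val i.
pose g (i : 'I_#|Q|) : 'I_n := enum_val i.
have /rowV0Pn[c /sub_kermxP cK c0] : kermx (mxsub f g K) != 0.
  rewrite -mxrank_eq0 mxrank_ker subn_eq0 -ltnNge.
  exact: leq_ltn_trans (rank_leq_col _) QP.
exists (c *m rowsub f 1%:M); split.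
- apply: contra c0 => /eqP/matrixP cE; apply/eqP/matrixP => i j.
  have := cE i (f j); rewrite mxE [in RHS]mxE (bigD1 j) //= big1 => [|k kj].
    by rewrite !mxE eqxx mulr1 addr0.
  rewrite !mxE; case: eqVneq => [fE|]; last by rewrite mulr0.
  by rewrite (enum_val_inj fE) eqxx in kj.
- move=> i iP; rewrite mxE big1 // => k _; rewrite !mxE.
  case: eqVneq => [fE|]; last by rewrite mulr0.
  by rewrite -fE enum_valP in iP.
move=> j jQ; rewrite -mulmxA mul_rowsub_mx mul1mx.
have /matrixP/(_ 0 (enum_rank_in jQ j)) := cK.
rewrite !mxE => E; rewrite -[RHS]E; apply: eq_bigr => k _; rewrite !mxE.
by rewrite /g enum_rankK_in.
Qed.

Lemma diag_quad n (d y : 'rV[R]_n) :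
  (y *m diag_mx d *m y^T) 0 0 = \sum_i d 0 i * y 0 i ^+ 2.
Proof.
rewrite mul_mx_diag mxE; apply: eq_bigr => i _; rewrite !mxE expr2.
by rewrite mulrA; congr (_ * _); rewrite mulrC.
Qed.

Lemma quad_entry_bound n (E : 'M[R]_n) (x : 'rV[R]_n) eps :
  (forall i j, `|E i j| <= eps) ->
  (x *m E *m x^T) 0 0 <= eps * n%:R * \sum_i x 0 i ^+ 2.
Proof.
move=> Ee; have H i j : x 0 i * E i j * x 0 j <= eps * (x 0 i ^+ 2 + x 0 j ^+ 2) / 2.
  have e0 : 0 <= eps by exact: le_trans (Ee i j).
  have : `|x 0 i * E i j * x 0 j| <= eps * `|x 0 i * x 0 j|.
    by rewrite mulrAC normrM mulrC ler_wpM2r.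
  move/(le_trans (ler_norm _))/le_trans; apply.
  rewrite -mulrA ler_wpM2l // normrM -[x 0 i ^+ 2]real_normK ?num_real //.
  rewrite -[x 0 j ^+ 2]real_normK ?num_real //.
  have := sqr_ge0 (`|x 0 i| - `|x 0 j|); rewrite !expr2; lra.
rewrite mxE; apply: le_trans (_ : \sum_j \sum_i eps * (x 0 i ^+ 2 + x 0 j ^+ 2) / 2 <= _).
  apply: ler_sum => j _; rewrite !mxE mulr_suml; apply: ler_sum => i _.
  exact: H.
pose S := \sum_i x 0 i ^+ 2.
under eq_bigr => j _.
  rewrite -mulr_suml -mulr_sumr big_split /= sumr_const card_ord -/S.
  over.
rewrite -mulr_suml -mulr_sumr big_split /= sumr_const card_ord sumrMnl -/S.
by rewrite -[S *+ n]mulr_natr; lra.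
Qed.

(** If [B] had fewer positive eigenvalues than [A], some nonzero vector would lie
    in the positive eigenspaces of [A] and in the nonpositive ones of [B]; on
    it the two quadratic forms differ by at least [m |x|^2], which is more
    than what a perturbation with entries at most [eps] can do. *)
Lemma inertia_le n (A B X Y : 'M[R]_n) (d e : 'rV[R]_n) m eps :
  orthogonal_group n X -> orthogonal_group n Y ->
  A = X *m diag_mx d *m X^T -> B = Y *m diag_mx e *m Y^T ->
  (forall i, 0 < d 0 i -> m <= d 0 i) ->
  (forall i j, `|(A - B) i j| <= eps) -> eps * n%:R < m ->
  (#|pos_set d| <= #|pos_set e|)%N.
Proof.
move=> Xo Yo AE BE dm AB em; rewrite leqNgt; apply/negP.
move=> /(vector_in_both (X^T *m Y))[y [y0 yP yQ]].
pose x := y *m X^T; pose z := y *m (X^T *m Y).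
have xA : x *m A *m x^T = y *m diag_mx d *m y^T.
  rewrite AE /x trmx_mul trmxK !mulmxA -(mulmxA y) orthoE // mulmx1.
  by rewrite -(mulmxA _ X^T) orthoE // mulmx1.
have xB : x *m B *m x^T = z *m diag_mx e *m z^T.
  by rewrite BE /x /z !trmx_mul trmxK !mulmxA.
have xx : \sum_i x 0 i ^+ 2 = \sum_i y 0 i ^+ 2.
  have sq (v : 'rV[R]_n) : \sum_i v 0 i ^+ 2 = (v *m v^T) 0 0.
    by rewrite mxE; apply: eq_bigr => i _; rewrite mxE expr2.
  by rewrite !sq /x trmx_mul trmxK mulmxA -(mulmxA y) orthoE // mulmx1.
have yy : 0 < \sum_i y 0 i ^+ 2.
  rewrite lt_def sumr_ge0 ?andbT => [|i _]; last exact: sqr_ge0.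
  apply: contra y0; rewrite psumr_eq0 => [/allP y0|i _]; last exact: sqr_ge0.
  apply/eqP/matrixP => i j; rewrite ord1 [RHS]mxE; apply/eqP.
  by have := y0 j (mem_index_enum j); rewrite sqrf_eq0.
have lb : m * (\sum_i y 0 i ^+ 2) <= (x *m A *m x^T) 0 0.
  rewrite xA diag_quad mulr_sumr; apply: ler_sum => i _.
  have [di|di] := boolP (0 < d 0 i); first by rewrite ler_wpM2r ?sqr_ge0 ?dm.
  by rewrite yP ?inE // expr0n /= !mulr0.
have ub : (x *m B *m x^T) 0 0 <= 0.
  rewrite xB diag_quad; apply: sumr_le0 => j _.
  have [ej|ej] := boolP (0 < e 0 j); last first.
    by rewrite mulr_le0_ge0 ?sqr_ge0 // leNgt.
  by rewrite yQ ?inE // expr0n /= mulr0.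
have := quad_entry_bound x AB; rewrite mulmxBr mulmxBl xx => qb.
have {}qb : (x *m A *m x^T) 0 0 - (x *m B *m x^T) 0 0 <=
    eps * n%:R * \sum_i y 0 i ^+ 2 by move: qb; rewrite mxE [X in _ + X]mxE.
have : eps * n%:R * (\sum_i y 0 i ^+ 2) < m * (\sum_i y 0 i ^+ 2).
  by rewrite ltr_pM2r.
lra.
Qed.

(** Applied to [A] and to [- A], [inertia_le] says that [B] has at least as many
    positive and at least as many negative eigenvalues as [A]; as [A] is
    nonsingular these numbers already add up to [n], so both are equalities
    and [B] is nonsingular. *)
Lemma GLSym_open n q (A : 'M[R]_n) : GLSym n q A ->
  exists2 eps, 0 < eps & forall B : 'M[R]_n, B^T = B ->
    (forall i j, `|(A - B) i j| <= eps) -> GLSym n q B.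
Proof.
move=> /GLSymP[X [d [Xo AE d0 dq]]].
pose m := \big[Num.min/1]_(i < n) `|d 0 i|.
have m0 : 0 < m by rewrite lt_bigmin // => i _; rewrite normr_gt0.
have md i : m <= `|d 0 i| by exact: bigmin_le_cond.
pose eps := m / (n%:R + 1).
have n1 : 0 < n%:R + 1 :> R by rewrite ltr_wpDl // ler0n.
have em : eps * n%:R < m.
  rewrite /eps mulrAC ltr_pdivrMr // ltr_pM2l // ltrDl //.
exists eps; first by rewrite divr_gt0.
move=> B Bs AB; have [Y [e [Yo BE]]] := real_spectral Bs.
have p1 : (#|pos_set d| <= #|pos_set e|)%N.
  by apply: inertia_le Xo Yo AE BE _ AB em => i /gtr0_norm <-.
have p2 : (#|pos_set (- d)| <= #|pos_set (- e)|)%N.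
  have oppE (Z : 'M[R]_n) (f : 'rV[R]_n) :
      - (Z *m diag_mx f *m Z^T) = Z *m diag_mx (- f) *m Z^T.
    by rewrite linearN mulmxN mulNmx.
  apply: (@inertia_le n (- A) (- B) X Y _ _ m eps) => //.
  - by rewrite AE oppE.
  - by rewrite BE oppE.
  - by move=> i; rewrite mxE oppr_gt0 => /ltr0_norm <-.
  - by move=> i j; rewrite -opprD mxE normrN.
have cardU (f : 'rV[R]_n) :
    (#|pos_set f :|: pos_set (- f)| = #|pos_set f| + #|pos_set (- f)|)%N.
  rewrite cardsU (_ : _ :&: _ = finset.set0) ?cards0 ?subn0 //.
  by apply/setP => i; rewrite !inE mxE oppr_gt0; case: ltrgt0P.
have dT : pos_set d :|: pos_set (- d) = [set: 'I_n]%SET.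
  apply/setP => i; rewrite !inE mxE oppr_gt0.
  by have := d0 i; case: ltrgt0P.
have /eqP eT : pos_set e :|: pos_set (- e) == [set: 'I_n]%SET.
  rewrite eqEcard finset.subsetT /= -dT !cardU.
  exact: leq_add.
apply/GLSymP; exists Y, e; split=> // [i|].
  have : i \in pos_set e :|: pos_set (- e) by rewrite eT inE.
  by rewrite !inE mxE oppr_gt0; case: ltrgt0P.
have := cardU d; have := cardU e; rewrite dT eT -dq => -> /eqP.
move: p1 p2; set a := #|_|; set b := #|_|; set c := #|_|; set f := #|_|.
by move=> p1 p2 /eqP; lia.
Qed.

End Inertia.

(** * The orbit of a diagonal matrix and its rational parametrization *)

Section Coordinates.
Variable R : realType.

Lemma comm_diagP n (d : 'rV[R]_n) (A : 'M[R]_n) :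
  diag_mx d *m A = A *m diag_mx d <->
  (forall i j, d 0 i != d 0 j -> A i j = 0).
Proof.
rewrite mul_diag_mx mul_mx_diag; split=> [/matrixP dA i j dij|Ad].
  have := dA i j; rewrite !mxE mulrC => /eqP.
  rewrite -subr_eq0 -mulrBr mulf_eq0 subr_eq0 (negPf dij) orbF.
  by move/eqP.
apply/matrixP => i j; rewrite !mxE mulrC.
by have [->|/Ad ->] := eqVneq (d 0 i) (d 0 j); rewrite ?mul0r.
Qed.

(** If [x (1 + A) = 0] then [0 = x (1 + A) x^T = x x^T], as the quadratic form of
    a skew-symmetric matrix vanishes. *)
Lemma skew_unit n (A : 'M[R]_n) : A^T = - A -> 1%:M + A \in unitmx.
Proof.
move=> As; rewrite -row_free_unit -kermx_eq0; apply/rowV0P => x /sub_kermxP xA.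
have : (x *m (1%:M + A) *m x^T) 0 0 = 0 by rewrite xA mul0mx mxE.
have xAx : (x *m A *m x^T) 0 0 = 0.
  have : (x *m A *m x^T)^T 0 0 = - (x *m A *m x^T) 0 0.
    by rewrite !trmx_mul trmxK As mulNmx mulmxN mulmxA mxE.
  by rewrite mxE; lra.
rewrite mulmxDr mulmx1 mulmxDl mxE xAx addr0 => xx.
apply/eqP; apply: contraTT isT => x0.
by have := @sqnorm_gt0 _ _ x^T; rewrite trmxK xx ltxx trmx_eq0 => /(_ x0).
Qed.

(** A full rank factorization [P = C B] of an idempotent matrix satisfies
    [B C = 1].  This provides coordinates on the image of a projector without
    enumerating the entries on which it is supported. *)
Lemma projection_coords m n (f : 'M[R]_(m, n) -> 'M[R]_(m, n)) :
  linear f -> (forall x, f (f x) = f x) ->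
  exists d (c : {linear 'M[R]_(m, n) -> 'rV[R]_d})
           (r : {linear 'rV[R]_d -> 'M[R]_(m, n)}),
    (forall v, c (r v) = v) /\ (forall x, r (c x) = f x).
Proof.
move=> fl fK; pose F : {linear _ -> _} := HB.pack f (GRing.isLinear.Build _ _ _ _ f fl).
pose P := lin_mx F; pose C := col_base P; pose B := row_base P.
have CB : C *m B = P by exact: mulmx_base.
have PP : P *m P = P.
  apply/row_matrixP => i; rewrite !rowE mulmxA.
  rewrite -[delta_mx 0 i]vec_mxK !mul_vec_lin /=.
  by rewrite fK.
have BC : B *m C = 1%:M.
  have E : C *m (B *m C) *m B = C *m 1%:M *m B.
    by rewrite mulmx1 mulmxA CB -mulmxA CB PP.
  exact: (row_full_inj (col_base_full P)) (row_free_inj (row_base_free P) E).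
exists (\rank P), (mulmxr C \o mxvec), (vec_mx \o mulmxr B); split=> x /=.
  by rewrite vec_mxK -mulmxA BC mulmx1.
by rewrite -mulmxA CB mul_vec_lin mxvecK.
Qed.

End Coordinates.

Section Slice.
Variables (R : realType) (n : nat) (a : 'rV[R]_n).
Hypothesis a0 : forall i, a 0 i != 0.
Implicit Types Z k w X : 'M[R]_n.

Let J := diag_mx a.

Definition orbit_set : set 'M[R]_n := [set X *m J *m X^T |
  X in [set X | orthogonal_group n X /\ (J *m J) *m X = X *m (J *m J)]].

(** [Jabs] is the absolute value of [J]; [Ppos] and [Pneg] are the orthogonal
    projectors on the sums of the eigenspaces of [J] for the positive and for
    the negative eigenvalues. *)
Definition Jabs : 'M[R]_n := diag_mx (map_mx Num.norm a).
Definition Ppos : 'M[R]_n := diag_mx (\row_i (0 < a 0 i)%R%:R).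
Definition Pneg : 'M[R]_n := 1%:M - Ppos.

Lemma Ppos_idem : Ppos *m Ppos = Ppos.
Proof.
rewrite /Ppos mulmx_diag; congr diag_mx; apply/matrixP => i j; rewrite !mxE.
by rewrite -natrM mulnb andbb.
Qed.

Lemma Ppos_Pneg : Ppos *m Pneg = 0.
Proof. by rewrite mulmxBr mulmx1 Ppos_idem subrr. Qed.

Lemma Pneg_Ppos : Pneg *m Ppos = 0.
Proof. by rewrite mulmxBl mul1mx Ppos_idem subrr. Qed.

Lemma Pneg_idem : Pneg *m Pneg = Pneg.
Proof. by rewrite {1}/Pneg mulmxBl mul1mx Ppos_Pneg subr0. Qed.

Lemma PposDneg : Ppos + Pneg = 1%:M. Proof. by rewrite addrC subrK. Qed.
Lemma tr_Ppos : Ppos^T = Ppos. Proof. exact: tr_diag_mx. Qed.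
Lemma tr_Pneg : Pneg^T = Pneg. Proof. by rewrite linearB /= trmx1 tr_Ppos. Qed.
Lemma tr_Jabs : Jabs^T = Jabs. Proof. exact: tr_diag_mx. Qed.
Lemma tr_J : J^T = J. Proof. exact: tr_diag_mx. Qed.
Lemma Jabs_Ppos : Jabs *m Ppos = Ppos *m Jabs. Proof. by rewrite diag_mxC. Qed.
Lemma Jabs_Pneg : Jabs *m Pneg = Pneg *m Jabs.
Proof. by rewrite mulmxBl mulmxBr mulmx1 mul1mx Jabs_Ppos. Qed.

Lemma J_signed : J = Jabs *m Ppos - Jabs *m Pneg.
Proof.
rewrite /Pneg mulmxBr mulmx1 opprB addrA /Jabs /Ppos mulmx_diag -!raddfD -raddfB.
congr diag_mx; apply/matrixP => i j; rewrite !mxE ord1.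
have := a0 j; case: ltrgt0P => [aj|aj|//] _; rewrite ?mulr1 ?mulr0 ?addr0 ?sub0r.
  by rewrite addrK.
by rewrite opprK.
Qed.

Lemma Jabs_sqr : Jabs *m Jabs = J *m J.
Proof.
rewrite /Jabs /J !mulmx_diag; congr diag_mx; apply/matrixP => i j; rewrite !mxE.
by rewrite -expr2 real_normK ?num_real // ord1 expr2.
Qed.

Lemma Jabs_unit : Jabs \in unitmx.
Proof.
rewrite unitmxE unitfE det_diag; apply/prodf_neq0 => i _.
by rewrite mxE normr_eq0.
Qed.

Lemma comm_sqr_Jabs X : (J *m J) *m X = X *m (J *m J) <-> Jabs *m X = X *m Jabs.
Proof.
split=> [|XS]; last by rewrite -Jabs_sqr -mulmxA XS mulmxA XS mulmxA.
rewrite {1 2}/J mulmx_diag !comm_diagP => H i j; rewrite !mxE => aij.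
apply: H; rewrite !mxE -!expr2; apply: contra aij.
by rewrite eqf_sqr => /orP[/eqP->//|/eqP->]; rewrite normrN.
Qed.

(** Projection on the commutant of [J^2].  The points of the orbit lie in this
    commutant, but the charts have to make sense for all symmetric matrices. *)
Definition block_part Z : 'M[R]_n :=
  \matrix_(i, j) if `|a 0 i| == `|a 0 j| then Z i j else 0.

Lemma block_part_linear : linear block_part.
Proof.
move=> c A B; apply/matrixP => i j; rewrite !mxE.
by case: ifP => _; rewrite ?mulr0 ?addr0.
Qed.

Lemma block_part_comm Z : Jabs *m block_part Z = block_part Z *m Jabs.
Proof. by apply/comm_diagP => i j; rewrite !mxE => /negPf ->. Qed.

Lemma block_part_id Z : Jabs *m Z = Z *m Jabs -> block_part Z = Z.
Proof.
move=> /comm_diagP H; apply/matrixP => i j; rewrite mxE; case: eqVneq => // ij.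
by rewrite H // !mxE.
Qed.

Lemma block_partT Z : block_part Z^T = (block_part Z)^T.
Proof. by apply/matrixP => i j; rewrite !mxE eq_sym. Qed.

(** In a block of [J^2] with eigenvalue [l^2], where [J = l (1 (+) -1)] and
    [Z = l B] with [B] a symmetric involution, [(B + 1) / 2] is the orthogonal
    projector on the eigenspace of [B] for the eigenvalue 1.  This eigenspace
    is spanned by the first columns of [B + 1]; as long as the upper left
    corner of [B + 1], that is, [head_mx Z], is invertible, it is the graph of
    the lower left corner times the inverse of the upper left one.  Adding
    [Jabs] puts an invertible diagonal on the remaining indices, so that the
    inverse is that of a square matrix of the full size. *)
Definition corner Z := Pneg *m block_part Z *m Ppos.
Definition head_part Z := Ppos *m block_part Z *m Ppos.
Definition head_mx Z := head_part Z + Jabs.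
Definition slope Z := corner Z *m invmx (head_mx Z).
(** The first columns of [tilt k] span the graph of [k] and the last ones its
    orthogonal complement. *)
Definition tilt k : 'M[R]_n := 1%:M + (k - k^T).
Definition orbit_param k := tilt k *m J *m invmx (tilt k).
Definition off_corner Z := Z - corner Z - (corner Z)^T.

Lemma corner_linear : linear corner.
Proof.
move=> c A B; rewrite /corner block_part_linear mulmxDr mulmxDl.
by rewrite -scalemxAr -scalemxAl.
Qed.

Lemma comm_Jabs_Pneg Z : Jabs *m Z = Z *m Jabs ->
  Jabs *m (Pneg *m Z *m Ppos) = Pneg *m Z *m Ppos *m Jabs.
Proof. by move=> SZ; rewrite !mulmxA Jabs_Pneg -(mulmxA Pneg) SZ -!mulmxA Jabs_Ppos. Qed.

Lemma comm_Jabs_Ppos Z : Jabs *m Z = Z *m Jabs ->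
  Jabs *m (Ppos *m Z *m Ppos) = Ppos *m Z *m Ppos *m Jabs.
Proof. by move=> SZ; rewrite !mulmxA Jabs_Ppos -(mulmxA Ppos) SZ -!mulmxA Jabs_Ppos. Qed.

Lemma cornerP k : corner k = k <->
  [/\ k *m Ppos = k, Ppos *m k = 0 & Jabs *m k = k *m Jabs].
Proof.
split=> [kE|[kP Pk Sk]].
  rewrite -kE; split; last exact/comm_Jabs_Pneg/block_part_comm.
    by rewrite /corner -mulmxA Ppos_idem.
  by rewrite /corner !mulmxA Ppos_Pneg !mul0mx.
by rewrite /corner block_part_id // mulmxBl mul1mx Pk subr0.
Qed.

Lemma cornerK Z : corner (corner Z) = corner Z.
Proof.
apply/cornerP; split; last exact/comm_Jabs_Pneg/block_part_comm.
  by rewrite /corner -mulmxA Ppos_idem.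
by rewrite /corner !mulmxA Ppos_Pneg !mul0mx.
Qed.

Lemma corner_tr Z : corner (corner Z)^T = 0.
Proof.
rewrite {1}/corner block_partT (block_part_id (comm_Jabs_Pneg (block_part_comm Z))).
by rewrite /corner !trmx_mul tr_Ppos tr_Pneg !mulmxA Pneg_Ppos !mul0mx.
Qed.

Lemma head_part_corner Z : head_part (corner Z) = 0.
Proof.
rewrite /head_part (block_part_id (comm_Jabs_Pneg (block_part_comm Z))).
by rewrite /corner !mulmxA Ppos_Pneg !mul0mx.
Qed.

Lemma head_part_linear : linear head_part.
Proof.
move=> c A B; rewrite /head_part block_part_linear mulmxDr mulmxDl.
by rewrite -scalemxAr -scalemxAl.
Qed.

Lemma head_partT Z : head_part Z^T = (head_part Z)^T.
Proof. by rewrite /head_part block_partT !trmx_mul tr_Ppos mulmxA. Qed.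

Lemma head_mx_comm_Jabs Z : Jabs *m head_mx Z = head_mx Z *m Jabs.
Proof.
by rewrite /head_mx mulmxDr mulmxDl (comm_Jabs_Ppos (block_part_comm Z)).
Qed.

Lemma head_mx_comm_Ppos Z : Ppos *m head_mx Z = head_mx Z *m Ppos.
Proof.
rewrite /head_mx mulmxDr mulmxDl Jabs_Ppos /head_part !mulmxA Ppos_idem.
by rewrite -[in RHS](mulmxA _ Ppos Ppos) Ppos_idem.
Qed.

(** In the singular case [invmx B] is [B] itself. *)
Lemma comm_invmx (A B : 'M[R]_n) : A *m B = B *m A -> A *m invmx B = invmx B *m A.
Proof.
move=> AB; have [Bu|Bu] := boolP (B \in unitmx); last by rewrite /invmx (negPf Bu).
by rewrite -[LHS]mul1mx -(mulVmx Bu) -!mulmxA (mulmxA B) -AB -mulmxA mulmxV // mulmx1.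
Qed.

Lemma slope_corner Z : corner (slope Z) = slope Z.
Proof.
have [cP Pc Sc] : [/\ corner Z *m Ppos = corner Z, Ppos *m corner Z = 0 &
    Jabs *m corner Z = corner Z *m Jabs] by apply/cornerP/cornerK.
apply/cornerP; rewrite /slope; split.
- by rewrite -mulmxA -(comm_invmx (head_mx_comm_Ppos Z)) mulmxA cP.
- by rewrite mulmxA Pc mul0mx.
by rewrite mulmxA Sc -!mulmxA (comm_invmx (head_mx_comm_Jabs Z)).
Qed.

Section Tilt.
Variable k : 'M[R]_n.
Hypothesis kc : corner k = k.
Let A := k - k^T.
Let W := tilt k.
Let G := W^T *m W.

Let kP : k *m Ppos = k. Proof. by have [] := (cornerP k).1 kc. Qed.
Let Pk : Ppos *m k = 0. Proof. by have [] := (cornerP k).1 kc. Qed.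
Let Sk : Jabs *m k = k *m Jabs. Proof. by have [] := (cornerP k).1 kc. Qed.
Let kTP : k^T *m Ppos = 0. Proof. by rewrite -tr_Ppos -trmx_mul Pk trmx0. Qed.
Let PkT : Ppos *m k^T = k^T. Proof. by rewrite -{1}tr_Ppos -trmx_mul kP. Qed.

Lemma tilt_tr : W^T = 1%:M - A.
Proof. by rewrite /W /tilt linearD linearB /= trmx1 trmxK opprB. Qed.

Lemma tilt_unit : W \in unitmx.
Proof. by apply: skew_unit; rewrite linearB /= trmxK opprB. Qed.

Lemma gram_unit : G \in unitmx.
Proof. by rewrite unitmx_mul unitmx_tr tilt_unit. Qed.

Lemma gramE : G = 1%:M - A *m A.
Proof.
by rewrite /G tilt_tr /W /tilt -/A mulmxBl mul1mx mulmxDr mulmx1 opprD addrA addrK.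
Qed.

Lemma tilt_Ppos : W *m Ppos = Ppos + k.
Proof. by rewrite /W /tilt mulmxDl mul1mx mulmxBl kP kTP subr0. Qed.

Let AP : A *m Ppos = k. Proof. by rewrite /A mulmxBl kP kTP subr0. Qed.
Let PA : Ppos *m A = - k^T. Proof. by rewrite /A mulmxBr Pk PkT sub0r. Qed.

(** [k - k^T] exchanges the images of [Ppos] and [Pneg], so its square preserves
    each of them. *)
Lemma gram_comm_Ppos : Ppos *m G = G *m Ppos.
Proof.
have kk : k *m k = 0 by rewrite -[X in X *m _]kP -mulmxA Pk mulmx0.
have kTkT : k^T *m k^T = 0 by rewrite -trmx_mul kk trmx0.
have PAA : Ppos *m (A *m A) = - (k^T *m k).
  by rewrite mulmxA PA mulNmx {1}/A mulmxBr kTkT subr0.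
have AAP : A *m A *m Ppos = - (k^T *m k).
  by rewrite -mulmxA AP {1}/A mulmxBl kk sub0r.
by rewrite gramE [LHS]mulmxBr [RHS]mulmxBl mulmx1 mul1mx PAA AAP.
Qed.

Lemma tilt_comm_Jabs : Jabs *m W = W *m Jabs.
Proof.
have SkT : Jabs *m k^T = k^T *m Jabs by rewrite -tr_Jabs -!trmx_mul Sk.
by rewrite /W /tilt mulmxDl mulmxDr mul1mx mulmx1 mulmxBl mulmxBr Sk SkT.
Qed.

Lemma gram_comm_Jabs : Jabs *m G = G *m Jabs.
Proof.
have WT : Jabs *m W^T = W^T *m Jabs by rewrite -tr_Jabs -!trmx_mul tilt_comm_Jabs.
by rewrite /G mulmxA WT -!mulmxA tilt_comm_Jabs.
Qed.

Lemma gram_comm_J : J *m G = G *m J.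
Proof.
have GPm : Pneg *m G = G *m Pneg.
  by rewrite /Pneg [LHS]mulmxBl [RHS]mulmxBr mul1mx mulmx1 gram_comm_Ppos.
rewrite J_signed [LHS]mulmxBl [RHS]mulmxBr -(mulmxA Jabs Ppos) gram_comm_Ppos.
by rewrite -(mulmxA Jabs Pneg) GPm (mulmxA Jabs G) (mulmxA Jabs G) gram_comm_Jabs -!(mulmxA G).
Qed.

Lemma orbit_param_comm : Jabs *m orbit_param k = orbit_param k *m Jabs.
Proof.
have SJ : Jabs *m J = J *m Jabs by rewrite diag_mxC.
have SV := comm_invmx tilt_comm_Jabs.
by rewrite /orbit_param -/W !mulmxA tilt_comm_Jabs -(mulmxA W) SJ -!mulmxA SV.
Qed.

Let T := invmx G.

(** [(orbit_param k + Jabs) / 2] is [Jabs] times the projector on the graph of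
    [k], whose classical expression is by means of the Gram matrix of a
    basis. *)
Lemma orbit_param_Ppos :
  (orbit_param k + Jabs) *m Ppos = 2 *: ((Ppos + k) *m Jabs *m T).
Proof.
have TP : Ppos *m T = T *m Ppos by exact/comm_invmx/gram_comm_Ppos.
have -> : orbit_param k + Jabs = W *m (J + Jabs) *m invmx W.
  rewrite mulmxDr mulmxDl -[W *m Jabs]tilt_comm_Jabs -[Jabs *m W *m _]mulmxA.
  by rewrite mulmxV ?tilt_unit // mulmx1.
have -> : J + Jabs = 2 *: (Ppos *m Jabs).
  rewrite J_signed -Jabs_Ppos scaler_nat mulr2n -addrA; congr (_ + _).
  by rewrite /Pneg mulmxBr mulmx1 opprB subrK.
have -> : invmx W = T *m (1%:M - A).
  by rewrite /T -tilt_tr -[RHS](mulmxK tilt_unit) -[_ *m W]mulmxA mulVmx ?gram_unit // mul1mx.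
rewrite -scalemxAr -!scalemxAl; congr (_ *: _).
have -> : W *m (Ppos *m Jabs) *m (T *m (1%:M - A)) *m Ppos =
    W *m Jabs *m T *m (Ppos *m (1%:M - A) *m Ppos).
  by rewrite -Jabs_Ppos !mulmxA -(mulmxA _ Ppos T) TP !mulmxA.
have -> : Ppos *m (1%:M - A) *m Ppos = Ppos.
  rewrite mulmxBr mulmx1 PA opprK mulmxDl Ppos_idem kTP addr0 //.
rewrite -!mulmxA -TP (mulmxA Jabs) Jabs_Ppos -!mulmxA (mulmxA W) tilt_Ppos //.
Qed.

Lemma head_orbit_param :
  head_mx (orbit_param k) = 2 *: (Ppos *m Jabs *m T) + Pneg *m Jabs.
Proof.
rewrite /head_mx /head_part block_part_id ?orbit_param_comm //.
have -> : Ppos *m orbit_param k *m Ppos = Ppos *m ((orbit_param k + Jabs) *m Ppos) - Ppos *m Jabs.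
  by rewrite mulmxDl mulmxDr !mulmxA -(mulmxA Ppos Jabs) Jabs_Ppos mulmxA Ppos_idem addrK.
rewrite orbit_param_Ppos -scalemxAr !mulmxA mulmxDr Ppos_idem Pk addr0.
by rewrite -addrA; congr (_ + _); rewrite /Pneg mulmxBl mul1mx addrC.
Qed.

Lemma corner_orbit_param :
  corner (orbit_param k) = k *m head_mx (orbit_param k).
Proof.
have kPm : k *m Pneg = 0 by rewrite mulmxBr mulmx1 kP subrr.
rewrite head_orbit_param mulmxDr (mulmxA k Pneg) kPm mul0mx addr0.
rewrite -scalemxAr !mulmxA kP /corner block_part_id ?orbit_param_comm //.
have -> : Pneg *m orbit_param k *m Ppos = Pneg *m ((orbit_param k + Jabs) *m Ppos).
  by rewrite mulmxDl mulmxDr !mulmxA -(mulmxA Pneg Jabs) Jabs_Ppos mulmxA Pneg_Ppos mul0mx addr0.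
rewrite orbit_param_Ppos -scalemxAr !mulmxA mulmxDr Pneg_Ppos add0r.
by rewrite /Pneg mulmxBl mul1mx Pk subr0.
Qed.

Lemma head_orbit_param_unit : head_mx (orbit_param k) \in unitmx.
Proof.
pose F := 2^-1 *: (Ppos *m invmx Jabs *m G) + Pneg *m invmx Jabs.
suff /mulmx1_unit[] : head_mx (orbit_param k) *m F = 1%:M by [].
have Su := Jabs_unit.
have SVP : Ppos *m invmx Jabs = invmx Jabs *m Ppos by apply: comm_invmx; rewrite Jabs_Ppos.
have TP : Ppos *m T = T *m Ppos by exact/comm_invmx/gram_comm_Ppos.
have SVT : T *m invmx Jabs = invmx Jabs *m T.
  by apply: comm_invmx; apply/esym/comm_invmx/gram_comm_Jabs.
rewrite head_orbit_param /F mulmxDl !mulmxDr -!scalemxAl -!scalemxAr scalerA.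
rewrite mulfV ?pnatr_eq0 // scale1r.
have -> : Ppos *m Jabs *m T *m (Pneg *m invmx Jabs) = 0.
  by rewrite -Jabs_Ppos -!mulmxA (mulmxA Ppos T) TP -!mulmxA (mulmxA Ppos) Ppos_Pneg mul0mx !mulmx0.
have -> : Pneg *m Jabs *m (Ppos *m invmx Jabs *m G) = 0.
  by rewrite -Jabs_Pneg !mulmxA -(mulmxA Jabs) Pneg_Ppos mulmx0 !mul0mx.
rewrite !scaler0 addr0 add0r.
have -> : Pneg *m Jabs *m (Pneg *m invmx Jabs) = Pneg.
  by rewrite -Jabs_Pneg !mulmxA -(mulmxA Jabs) Pneg_idem Jabs_Pneg mulmxK.
have -> : Ppos *m Jabs *m T *m (Ppos *m invmx Jabs *m G) = Ppos.
  rewrite SVP -(mulmxA (invmx Jabs)) gram_comm_Ppos (mulmxA _ (invmx Jabs)).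
  rewrite -(mulmxA _ T) SVT (mulmxA _ (invmx Jabs)) mulmxK // -(mulmxA Ppos T).
  by rewrite (mulmxA T G) mulVmx ?gram_unit // mul1mx Ppos_idem.
exact: PposDneg.
Qed.

Lemma slope_orbit_param : slope (orbit_param k) = k.
Proof. by rewrite /slope corner_orbit_param mulmxK // head_orbit_param_unit. Qed.

End Tilt.

(** The positive eigenspaces of a point [Z] of the orbit span the image of
    [Z + Jabs].  The columns of [tilt k] with positive index lie there, because
    [(Z - Jabs) (Z + Jabs) = 0], and they span it by a comparison of ranks;
    the remaining columns are orthogonal to it, so [Z + Jabs] kills them.  Thus
    [tilt k] conjugates [J] to [Z]. *)
Lemma orbit_param_slope Z : orbit_set Z -> head_mx Z \in unitmx ->
  orbit_param (slope Z) = Z.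
Proof.
move=> [X /= [Xo XJ] ZE] Eu.
have XS := (comm_sqr_Jabs X).1 XJ.
have XTS : Jabs *m X^T = X^T *m Jabs by rewrite -tr_Jabs -!trmx_mul XS.
have SJ : Jabs *m J = J *m Jabs by rewrite diag_mxC.
have ZS : Jabs *m Z = Z *m Jabs.
  by rewrite -ZE !mulmxA XS -(mulmxA X) SJ -!mulmxA XTS.
have ZT : Z^T = Z by rewrite -ZE !trmx_mul trmxK tr_J mulmxA.
have ZZ : Z *m Z = Jabs *m Jabs.
  rewrite -ZE !mulmxA -(mulmxA _ X^T) orthoE // mulmx1 -(mulmxA X) -XJ Jabs_sqr.
  by rewrite -mulmxA Xo mulmx1.
set k := slope Z; have kc : corner k = k by exact: slope_corner.
have [kP Pk Sk] := (cornerP k).1 kc; set E := head_mx Z in Eu.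
have Np : corner Z = k *m E by rewrite /k /slope mulmxKV.
have ZP : (Z + Jabs) *m Ppos = tilt k *m Ppos *m E.
  rewrite tilt_Ppos // [RHS]mulmxDl -Np [LHS]mulmxDl /E /head_mx /head_part /corner.
  rewrite block_part_id // mulmxDr !mulmxA Ppos_idem Jabs_Ppos.
  by rewrite addrAC -mulmxDl -mulmxDl PposDneg mul1mx.
have Weq : (Z - Jabs) *m (tilt k *m Ppos) = 0.
  apply: (can_inj (mulmxK Eu)); rewrite mul0mx -!mulmxA (mulmxA _ Ppos) -ZP mulmxA.
  suff -> : (Z - Jabs) *m (Z + Jabs) = 0 by rewrite mul0mx.
  by rewrite mulmxBl !mulmxDr ZZ ZS [X in _ - X]addrC subrr.
(* Z + |J| is conjugate to J + |J| = 2 |J| P+. *)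
have rZ : \rank (Z + Jabs)%R = \rank Ppos.
  have -> : Z + Jabs = X *m (2 *: (Ppos *m Jabs)) *m X^T.
    rewrite (_ : 2 *: _ = J + Jabs); last first.
      rewrite J_signed -Jabs_Ppos scaler_nat mulr2n -addrA; congr (_ + _).
      by rewrite /Pneg mulmxBr mulmx1 opprB subrK.
    by rewrite mulmxDr mulmxDl -XS -[_ *m X *m _]mulmxA Xo mulmx1 ZE.
  rewrite mxrankMfree; last by rewrite row_free_unit unitmx_tr ortho_unit.
  rewrite -mxrank_tr trmx_mul mxrankMfree; last first.
    by rewrite row_free_unit unitmx_tr ortho_unit.
  rewrite mxrank_tr mxrank_scale_nz ?pnatr_eq0 // mxrankMfree //.
  by rewrite row_free_unit Jabs_unit.
have PZ : Ppos *m (Z + Jabs) = E^T *m Ppos *m (tilt k)^T.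
  by rewrite -{1}tr_Ppos -{1}ZT -{1}tr_Jabs -linearD -trmx_mul ZP !trmx_mul tr_Ppos mulmxA.
have [D DE] : exists D, Z + Jabs = D *m (Ppos *m (Z + Jabs)).
  apply/submxP; rewrite -(geq_leqif (mxrank_leqif_sup (submxMl Ppos (Z + Jabs)))).
  rewrite rZ PZ mxrankMfree; last by rewrite row_free_unit unitmx_tr tilt_unit.
  by rewrite -[leqRHS]mxrank_tr trmx_mul trmxK tr_Ppos mxrankMfree ?row_free_unit.
have Weq' : (Z + Jabs) *m (tilt k *m Pneg) = 0.
  rewrite DE PZ -!mulmxA (mulmxA (tilt k)^T).
  rewrite {1}/Pneg mulmxBr mulmx1 -gram_comm_Ppos // mulmxBr.
  by rewrite (mulmxA Ppos Ppos) Ppos_idem subrr !mulmx0.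
have ZW : Z *m tilt k = tilt k *m J.
  have -> : Z *m tilt k = Z *m (tilt k *m Ppos) + Z *m (tilt k *m Pneg).
    by rewrite -mulmxDr -mulmxDr PposDneg mulmx1.
  move/eqP: Weq; rewrite (mulmxBl Z Jabs) subr_eq0 => /eqP ->.
  move/eqP: Weq'; rewrite (mulmxDl Z Jabs) addr_eq0 => /eqP ->.
  by rewrite J_signed [RHS]mulmxBr !mulmxA tilt_comm_Jabs.
by rewrite /orbit_param -ZW mulmxK // tilt_unit.
Qed.

Lemma gram_posdef k : corner k = k -> posdef ((tilt k)^T *m tilt k).
Proof.
move=> kc x x0; rewrite mulmxA -(mulmxA _ (tilt k)) -trmx_mul.
apply: sqnorm_gt0; apply: contra x0 => /eqP kx.
by rewrite -(mulKmx (tilt_unit k) x) kx mulmx0.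
Qed.

(** If [C C^T = W^T W] then [W C^-T] is orthogonal.  It conjugates [J] to the
    same matrix as [W], because [W^T W] commutes with [J] and the Cholesky
    factor inherits this. *)
Lemma smooth_orbit_section (V : normedModType R) (k : V -> 'M[R]_n) :
  entry_smooth setT k -> (forall v, corner (k v) = k v) ->
  exists s : V -> 'M[R]_n, entry_smooth setT s /\ forall v,
    [/\ orthogonal_group n (s v), (J *m J) *m s v = s v *m (J *m J) &
        s v *m J *m (s v)^T = orbit_param (k v)].
Proof.
move=> ks kc; pose P v := (tilt (k v))^T *m tilt (k v).
have oT : open [set: V] by exact: openT.
have Ws : entry_smooth setT (fun v => tilt (k v)).
  apply: entry_smoothD => //; first exact: entry_smooth_cst.
  by apply: entry_smoothB => //; exact: entry_smooth_tr.
have Ps : entry_smooth setT P.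
  by apply: entry_smoothM => //; exact: entry_smooth_tr.
have [v _|v _|C [Cs CP]] := smooth_cholesky (a := fun i => a 0 i) oT Ps.
- by split; [rewrite /P trmx_mul trmxK | exact: gram_posdef].
- by apply/comm_diagP/gram_comm_J.
have Pu v : P v \in unitmx by exact: gram_unit.
have Cu v : C v \in unitmx.
  have [CC _] := CP v I; have := Pu v.
  by rewrite -CC unitmx_mul => /andP[].
have CJ v : J *m C v = C v *m J by apply/comm_diagP; have [] := CP v I.
exists (fun v => tilt (k v) *m (invmx (C v))^T); split.
  apply: entry_smoothM => //; apply: entry_smooth_tr => //.
  exact: entry_smooth_inv.
move=> v; set W := tilt _; set D := invmx _.
have DJ : J *m D^T = D^T *m J.
  by rewrite -tr_J -!trmx_mul (comm_invmx (CJ v)).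
have Wu : W \in unitmx by exact: tilt_unit.
have DPD : D *m (P v) *m D^T = 1%:M.
  have [<- _] := CP v I; rewrite mulmxA mulVmx // mul1mx -trmx_mul mulVmx //.
  by rewrite trmx1.
split.
- apply: mulmx1C; rewrite trmx_mul trmxK !mulmxA -(mulmxA D) -/W.
  exact: DPD.
- have WJ : J *m J *m W = W *m (J *m J) by apply/comm_sqr_Jabs/tilt_comm_Jabs.
  by rewrite mulmxA WJ -!mulmxA DJ (mulmxA J) DJ !mulmxA.
rewrite trmx_mul trmxK -(mulmxA W) -DJ /orbit_param -/W -!mulmxA.
congr (W *m (J *m _)).
apply: (can_inj (mulmxK Wu)); rewrite mulVmx // -mulmxA -(mulmxA D) -[_^T *m W]/(P v).
by apply: mulmx1C; exact: DPD.
Qed.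

Lemma orbit_param_orbit k : corner k = k -> orbit_set (orbit_param k).
Proof.
move=> kc; pose f := fun _ : R => k.
have [|//|s [_ sP]] := @smooth_orbit_section R f.
  exact: entry_smooth_cst.
by have [so sJ sE] := sP 0; exists (s 0).
Qed.

Lemma orbit_setT Z : orbit_set Z -> Z^T = Z.
Proof. by move=> [X _ <-]; rewrite !trmx_mul trmxK tr_J mulmxA. Qed.

End Slice.

(** * Coordinates on symmetric matrices adapted to the orbit *)

(** Charts whose inverse is defined and smooth on the whole coordinate space:
    the image of the chart is then the preimage of [U] by the inverse, which
    makes its openness automatic. *)
Lemma embedded_chart (R : realType) m n d (X U : set 'M[R]_(m, n))
    (cm : 'M[R]_(m, n) -> 'rV[R]_d) (ci : 'rV[R]_d -> 'M[R]_(m, n)) :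
  open U -> entry_smooth U cm -> entry_smooth setT ci ->
  (forall x, X x -> U x -> ci (cm x) = x) ->
  (forall v, U (ci v) -> X (ci v) /\ cm (ci v) = v) ->
  let c := Chart (X `&` U) cm ci in
  embedded_atlas d X c /\ cod c = [set v | U (ci v)].
Proof.
move=> oU cms cis cmK ciK c.
have codE : cod c = [set v | U (ci v)].
  rewrite /cod /=; apply/seteqP; split=> [_ [x [Xx Ux] <-]|v Uv] /=.
    by rewrite cmK.
  by have [Xv vE] := ciK v Uv; exists (ci v).
split=> //; split.
- split=> [|x [Xx Ux]]; last exact: cmK.
  rewrite codE; apply: open_comp oU => v _.
  exact: (entry_smooth_continuous openT cis).
- by exists U.
- move=> x [Xx Ux]; exists U, cm; split=> //; exact: entry_smooth_smooth.
move=> v _; exists setT, ci; split=> //; first exact: openT.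
by apply: entry_smooth_smooth => //; exact: openT.
Qed.

Section Charts.
Variables (R : realType) (n : nat) (a : 'rV[R]_n).
Hypothesis a0 : forall i, a 0 i != 0.
Implicit Types Z k w g : 'M[R]_n.

Lemma sym_addT (w N : 'M[R]_n) : w^T = w -> (w + N + N^T)^T = w + N + N^T.
Proof. by move=> wT; rewrite !linearD /= trmxK wT addrAC. Qed.

Lemma off_cornerT Z : Z^T = Z -> (off_corner a Z)^T = off_corner a Z.
Proof.
by move=> ZT; rewrite /off_corner !linearB /= trmxK ZT addrAC.
Qed.

Lemma off_cornerE Z : off_corner a Z + corner a Z + (corner a Z)^T = Z.
Proof. by rewrite /off_corner addrAC subrK subrK. Qed.

Lemma cornerB Z Z' : corner a (Z - Z') = corner a Z - corner a Z'.
Proof. by rewrite -[Z - Z']addrC -scaleN1r corner_linear scaleN1r addrC. Qed.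

Lemma head_partB Z Z' : head_part a (Z - Z') = head_part a Z - head_part a Z'.
Proof. by rewrite -[Z - Z']addrC -scaleN1r head_part_linear scaleN1r addrC. Qed.

Lemma corner_off_corner Z : corner a (off_corner a Z) = 0.
Proof. by rewrite /off_corner !cornerB cornerK corner_tr subrr subr0. Qed.

Lemma head_off_corner Z : head_mx a (off_corner a Z) = head_mx a Z.
Proof.
rewrite /head_mx /off_corner !head_partB head_partT !head_part_corner.
by rewrite trmx0 !subr0.
Qed.

Lemma off_corner_id Z : corner a Z = 0 -> off_corner a Z = Z.
Proof. by rewrite /off_corner => ->; rewrite trmx0 !subr0. Qed.

Lemma off_corner_linear : linear (off_corner a).
Proof.
move=> c A B; rewrite /off_corner corner_linear [(_ + _)^T]linearD /=.
rewrite [(c *: _)^T]linearZ /= !scalerBr !opprD.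
by rewrite (addrACA (c *: A) B) (addrACA (_ - _) (B - _)).
Qed.

(** A projector of the space of all matrices on the symmetric matrices with zero
    corner, which complement the corners among the symmetric matrices. *)
Definition sym_off_corner Z := off_corner a (2^-1 *: (Z + Z^T)).

Lemma sym_off_corner_linear : linear sym_off_corner.
Proof.
move=> c A B; rewrite /sym_off_corner -off_corner_linear; congr off_corner.
rewrite [(c *: A + B)^T]linearD /= [(c *: A)^T]linearZ /= addrACA -scalerDr.
by rewrite [LHS]scalerDr !scalerA mulrC.
Qed.

Lemma sym_off_corner_sym Z : Z^T = Z -> sym_off_corner Z = off_corner a Z.
Proof.
move=> ZT; have ZZ : Z + Z = (2 : R) *: Z by rewrite scaler_nat mulr2n.
rewrite /sym_off_corner ZT ZZ scalerA.
by rewrite mulVf ?pnatr_eq0 // scale1r.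
Qed.

Lemma sym_off_cornerT Z : (sym_off_corner Z)^T = sym_off_corner Z.
Proof.
by apply: off_cornerT; rewrite linearZ /= linearD /= trmxK addrC.
Qed.

Lemma corner_sym_off_corner Z : corner a (sym_off_corner Z) = 0.
Proof. exact: corner_off_corner. Qed.

Lemma sym_off_cornerK Z : sym_off_corner (sym_off_corner Z) = sym_off_corner Z.
Proof.
rewrite {1}sym_off_corner_sym ?sym_off_cornerT //.
by rewrite off_corner_id // corner_sym_off_corner.
Qed.

Variables (d e : nat).
Variables (c1 : {linear 'M[R]_n -> 'rV[R]_d}) (r1 : {linear 'rV[R]_d -> 'M[R]_n}).
Variables (c2 : {linear 'M[R]_n -> 'rV[R]_e}) (r2 : {linear 'rV[R]_e -> 'M[R]_n}).
Hypotheses (c1K : forall v, c1 (r1 v) = v) (r1E : forall Z, r1 (c1 Z) = corner a Z).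
Hypotheses (c2K : forall v, c2 (r2 v) = v)
  (r2E : forall Z, r2 (c2 Z) = sym_off_corner Z).

Lemma corner_r1 z : corner a (r1 z) = r1 z.
Proof. by rewrite -r1E c1K. Qed.

Lemma r2_sym z : (r2 z)^T = r2 z.
Proof. by rewrite -[z]c2K r2E sym_off_cornerT. Qed.

Lemma corner_r2 z : corner a (r2 z) = 0.
Proof. by rewrite -[z]c2K r2E corner_sym_off_corner. Qed.

Lemma c1_corner Z : c1 (corner a Z) = c1 Z.
Proof. by rewrite -r1E c1K. Qed.

Lemma c2_sym_off Z : c2 (sym_off_corner Z) = c2 Z.
Proof. by rewrite -r2E c2K. Qed.

Definition lin_map Z : 'rV[R]_(d + e) := row_mx (c1 Z) (c2 Z).
Definition lin_inv (v : 'rV[R]_(d + e)) : 'M[R]_n :=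
  r2 (rsubmx v) + r1 (lsubmx v) + (r1 (lsubmx v))^T.

Lemma lin_mapK Z : Z^T = Z -> lin_inv (lin_map Z) = Z.
Proof.
move=> ZT; rewrite /lin_inv /lin_map row_mxKl row_mxKr r1E r2E.
by rewrite sym_off_corner_sym // off_cornerE.
Qed.

Lemma lin_invT v : (lin_inv v)^T = lin_inv v.
Proof. by apply: sym_addT; rewrite r2_sym. Qed.

Lemma lin_invK v : lin_map (lin_inv v) = v.
Proof.
rewrite -[RHS]hsubmxK /lin_map /lin_inv; set x := lsubmx v; set y := rsubmx v.
have cE : corner a (r2 y + r1 x + (r1 x)^T) = r1 x.
  rewrite -[r2 y + _ + _]addrC -[(r1 x)^T]scale1r corner_linear scale1r.
  rewrite -[r2 y]scale1r corner_linear corner_r2 scaler0 add0r corner_r1.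
  by rewrite -(corner_r1 x) corner_tr add0r.
congr row_mx; first by rewrite -c1_corner cE c1K.
rewrite -c2_sym_off sym_off_corner_sym ?(lin_invT v) //.
by rewrite /off_corner cE addrAC addrK addrK c2K.
Qed.

(** The first coordinates are those of the slope, the others measure the distance
    to the point of the orbit with the same slope, so that the orbit is where
    the latter vanish.  The inverse first restores the entries outside of the
    corner, which determine [head_mx], and the corner is then the slope times
    [head_mx]. *)
Definition slice_map Z : 'rV[R]_(d + e) :=
  row_mx (c1 (slope a Z)) (c2 (Z - orbit_param a (slope a Z))).
Definition slice_inv (v : 'rV[R]_(d + e)) : 'M[R]_n :=
  let k := r1 (lsubmx v) in
  let w := r2 (rsubmx v) + off_corner a (orbit_param a k) in
  w + k *m head_mx a w + (k *m head_mx a w)^T.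

Lemma orbit_paramT k : corner a k = k -> (orbit_param a k)^T = orbit_param a k.
Proof. by move=> kc; apply: orbit_setT; exact: orbit_param_orbit. Qed.

Section SliceInv.
Variable v : 'rV[R]_(d + e).
Let k := r1 (lsubmx v).
Let w := r2 (rsubmx v) + off_corner a (orbit_param a k).
Let kc : corner a k = k. Proof. exact: corner_r1. Qed.

Let wT : w^T = w.
Proof. by rewrite /w linearD /= r2_sym off_cornerT ?orbit_paramT. Qed.

Let wc : corner a w = 0.
Proof.
rewrite /w -[r2 _]scale1r corner_linear corner_r2 scaler0 add0r.
by rewrite corner_off_corner.
Qed.

Lemma slice_invT : (slice_inv v)^T = slice_inv v.
Proof. exact: sym_addT. Qed.

Let N := k *m head_mx a w.

Let Nc : corner a N = N.
Proof.
have [kP Pk Sk] := (cornerP a k).1 kc; apply/cornerP; split.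
- by rewrite /N -mulmxA -head_mx_comm_Ppos mulmxA kP.
- by rewrite /N mulmxA Pk mul0mx.
by rewrite /N mulmxA Sk -!mulmxA head_mx_comm_Jabs.
Qed.

Let corner_inv : corner a (slice_inv v) = N.
Proof.
rewrite /slice_inv -/k -/w -/N -[w]scale1r addrC -[N^T]scale1r corner_linear.
by rewrite scale1r corner_linear wc scaler0 add0r Nc -{1}Nc corner_tr add0r.
Qed.

Let off_corner_inv : off_corner a (slice_inv v) = w.
Proof. by rewrite /off_corner corner_inv /slice_inv -/k -/w -/N addrAC addrK addrK. Qed.

Lemma slice_invK : head_mx a (slice_inv v) \in unitmx -> slice_map (slice_inv v) = v.
Proof.
have hE : head_mx a (slice_inv v) = head_mx a w.
  by rewrite -off_corner_inv head_off_corner.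
rewrite hE => Eu; rewrite -[RHS]hsubmxK /slice_map.
have -> : slope a (slice_inv v) = k by rewrite /slope corner_inv hE /N mulmxK.
congr row_mx; first by rewrite c1K.
rewrite -c2_sym_off sym_off_corner_sym; last first.
  by rewrite linearB /= slice_invT orbit_paramT.
rewrite (_ : off_corner a _ = r2 (rsubmx v)) ?c2K //.
have -> : off_corner a (slice_inv v - orbit_param a k) =
    off_corner a (slice_inv v) - off_corner a (orbit_param a k).
  rewrite -!sym_off_corner_sym ?orbit_paramT ?slice_invT //; last first.
    by rewrite linearB /= slice_invT orbit_paramT.
  rewrite -[slice_inv v - _]addrC -scaleN1r sym_off_corner_linear.
  by rewrite scaleN1r addrC.
by rewrite off_corner_inv /w addrK.
Qed.

End SliceInv.

Lemma slice_mapK Z : Z^T = Z -> head_mx a Z \in unitmx ->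
  slice_inv (slice_map Z) = Z.
Proof.
move=> ZT Eu; rewrite /slice_inv /slice_map row_mxKl row_mxKr r1E r2E slope_corner.
set k := slope a Z; have kT := orbit_paramT (slope_corner a Z).
rewrite sym_off_corner_sym; last by rewrite linearB /= ZT kT.
have -> : off_corner a (Z - orbit_param a k) + off_corner a (orbit_param a k) =
    off_corner a Z.
  rewrite -!sym_off_corner_sym ?kT ?ZT //; last by rewrite linearB /= ZT kT.
  by rewrite -[sym_off_corner (Z - _)]scale1r -sym_off_corner_linear scale1r subrK.
by rewrite head_off_corner /k /slope mulmxKV // off_cornerE.
Qed.

Lemma slice_inv_orbit z : slice_inv (row_mx z 0) = orbit_param a (r1 z).
Proof.
rewrite /slice_inv row_mxKl row_mxKr linear0 add0r head_off_corner.
by rewrite -corner_orbit_param ?corner_r1 // off_cornerE.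
Qed.

End Charts.

(** * The orbit as a submanifold and as a homogeneous space *)

Section Manifold.
Variables (R : realType) (n : nat) (a : 'rV[R]_n) (Q : 'M[R]_n).
Hypotheses (a0 : forall i, a 0 i != 0) (Qo : orthogonal_group n Q).
Implicit Types Y Z k w g X : 'M[R]_n.

Let J := diag_mx a.
Let G := centralizer (J *m J) `&` orthogonal_group n.
Let H := centralizer J `&` orthogonal_group n.

Definition conj_orbit : set 'M[R]_n := [set Q *m X *m J *m X^T *m Q^T | X in G].
Let S := conj_orbit.

Let GP X : G X <-> orthogonal_group n X /\ (J *m J) *m X = X *m (J *m J).
Proof.
by split=> [[[_ XJ] Xo]|[Xo XJ]]; split=> //; split=> //; exact: ortho_unit.
Qed.

Let GM X Y : G X -> G Y -> G (X *m Y).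
Proof.
move=> /GP[Xo XJ] /GP[Yo YJ]; apply/GP; split; first exact: orthoM.
by rewrite mulmxA XJ -mulmxA YJ mulmxA.
Qed.

Let GT X : G X -> G X^T.
Proof.
move=> /GP[Xo XJ]; apply/GP; split; first exact: orthoT.
have JJT : (J *m J)^T = J *m J by rewrite trmx_mul tr_J.
by rewrite -{1}JJT -trmx_mul -XJ trmx_mul JJT.
Qed.

Variables (d e : nat).
Variables (c1 : {linear 'M[R]_n -> 'rV[R]_d}) (r1 : {linear 'rV[R]_d -> 'M[R]_n}).
Variables (c2 : {linear 'M[R]_n -> 'rV[R]_e}) (r2 : {linear 'rV[R]_e -> 'M[R]_n}).
Hypotheses (c1K : forall v, c1 (r1 v) = v) (r1E : forall Z, r1 (c1 Z) = corner a Z).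
Hypotheses (c2K : forall v, c2 (r2 v) = v)
  (r2E : forall Z, r2 (c2 Z) = sym_off_corner a Z).

(** The charts at the point [g J g^T], where [g = Q X0], are those at [J] carried
    by conjugation by [g]. *)
Section Base.
Variables X0 g : 'M[R]_n.
Hypotheses (X0G : G X0) (gE : g = Q *m X0).

Let go : orthogonal_group n g.
Proof. by rewrite gE; apply: orthoM => //; have /GP[] := X0G. Qed.

Let gK Z : g^T *m (g *m Z *m g^T) *m g = Z.
Proof. by rewrite !mulmxA orthoE // mul1mx -mulmxA orthoE // mulmx1. Qed.

Let gTK Y : g *m (g^T *m Y *m g) *m g^T = Y.
Proof. by rewrite !mulmxA [g *m _]go mul1mx -mulmxA [g *m _]go mulmx1. Qed.

Let back Y := g^T *m Y *m g.

Let back_sym Y : Y^T = Y -> (back Y)^T = back Y.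
Proof. by move=> YT; rewrite /back !trmx_mul trmxK YT mulmxA. Qed.

Let back_orbit Y : S Y <-> orbit_set a (back Y).
Proof.
split=> [[X XG <-]|[X [Xo XJ] XE]].
  have /GP[Zo ZJ] := GM (GT X0G) XG; exists (X0^T *m X) => //.
  rewrite /back gE !trmx_mul trmxK !mulmxA -(mulmxA _ Q^T Q) orthoE // mulmx1.
  by rewrite -(mulmxA _ Q^T Q) orthoE // mulmx1.
exists (X0 *m X); first by apply: GM => //; apply/GP.
by rewrite -[RHS]gTK -/(back Y) -XE gE !trmx_mul !mulmxA.
Qed.

Definition slice_dom : set 'M[R]_n := [set Y | head_mx a (back Y) \in unitmx].

Let back_smooth (U : set 'M[R]_n) : open U -> entry_smooth U back.
Proof.
move=> oU; apply: entry_smoothM => //; last exact: entry_smooth_cst.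
by apply: entry_smoothM => //; [exact: entry_smooth_cst|exact: entry_smooth_id].
Qed.

Lemma entry_smooth_corner_head (V : normedModType R) (U : set V) (F : V -> 'M[R]_n) :
  open U -> entry_smooth U F ->
  entry_smooth U (fun x => corner a (F x)) /\ entry_smooth U (fun x => head_mx a (F x)).
Proof.
move=> oU FU.
have bU : entry_smooth U (fun x => block_part a (F x)).
  move=> i j; have [ij|ij] := eqVneq `|a 0 i| `|a 0 j|.
    by apply: smooth_ext (FU i j) => // x _; rewrite mxE ij eqxx.
  apply: smooth_ext (fun l => Ck_cst l U (0 : R)) => // x _.
  by rewrite mxE (negPf ij).
split.
  apply: entry_smoothM => //; last exact: entry_smooth_cst.
  by apply: entry_smoothM => //; exact: entry_smooth_cst.
apply: entry_smoothD => //; last exact: entry_smooth_cst.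
apply: entry_smoothM => //; last exact: entry_smooth_cst.
by apply: entry_smoothM => //; exact: entry_smooth_cst.
Qed.

Lemma open_slice_dom : open slice_dom.
Proof.
have oT : open [set: 'M[R]_n] by exact: openT.
have [_ hs] := entry_smooth_corner_head oT (back_smooth oT).
have ds : smooth setT (fun Y => \det (head_mx a (back Y))) by exact: smooth_det.
have -> : slice_dom = (fun Y => \det (head_mx a (back Y))) @^-1` [set x | x != 0].
  by apply/seteqP; split=> Y /=; rewrite /slice_dom /= unitmxE unitfE.
apply: open_comp; last exact: open_neq.
by move=> Y _; exact: (ds 0%N Y I).
Qed.

Lemma slope_smooth : entry_smooth slice_dom (fun Y => slope a (back Y)).
Proof.
have oU := open_slice_dom.
have [cs hs] := entry_smooth_corner_head oU (back_smooth oU).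
by apply: entry_smoothM => //; apply: entry_smooth_inv.
Qed.

Lemma orbit_param_smooth (V : normedModType R) (U : set V) (k : V -> 'M[R]_n) :
  open U -> (forall x, U x -> corner a (k x) = k x) -> entry_smooth U k ->
  entry_smooth U (fun x => orbit_param a (k x)).
Proof.
move=> oU kc ks; have ts : entry_smooth U (fun x => tilt (k x)).
  apply: entry_smoothD => //; first exact: entry_smooth_cst.
  by apply: entry_smoothB => //; exact: entry_smooth_tr.
apply: entry_smoothM => //.
  by apply: entry_smoothM => //; exact: entry_smooth_cst.
by apply: entry_smooth_inv => // x Ux; exact: tilt_unit.
Qed.

Definition orbit_chart : chart R 'M[R]_n d :=
  Chart (S `&` slice_dom) (fun Y => c1 (slope a (back Y)))
    (fun z => g *m orbit_param a (r1 z) *m g^T).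

Let r1c z : corner a (r1 z) = r1 z. Proof. by rewrite -r1E c1K. Qed.

Let r1_smooth : entry_smooth setT (fun z : 'rV[R]_d => r1 z).
Proof.
by apply: (entry_smooth_lin r1) openT _; apply: entry_smooth_id; exact: openT.
Qed.

Let conj_smooth (V : normedModType R) (U : set V) (F : V -> 'M[R]_n) : open U ->
  entry_smooth U F -> entry_smooth U (fun x => g *m F x *m g^T).
Proof.
move=> oU FU; apply: entry_smoothM => //; last exact: entry_smooth_cst.
by apply: entry_smoothM => //; exact: entry_smooth_cst.
Qed.

(** The image of the chart is the whole coordinate space since [orbit_param] is
    defined for all slopes. *)
Lemma orbit_chartP : embedded_atlas d S orbit_chart /\ cod orbit_chart = setT.
Proof.
have := @embedded_chart R n n d S slice_dom (cmap orbit_chart) (cinv orbit_chart).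
case=> /=.
- exact: open_slice_dom.
- by apply: entry_smooth_lin => //; [exact: open_slice_dom|exact: slope_smooth].
- apply: conj_smooth; first exact: openT.
  by apply: orbit_param_smooth r1_smooth => //; exact: openT.
- move=> Y /back_orbit SY Eu; rewrite r1E slope_corner orbit_param_slope //.
  exact: gTK.
- move=> z _; rewrite /back gK slope_orbit_param //; split; last exact: c1K.
  by apply/back_orbit; rewrite /back gK; exact: orbit_param_orbit.
move=> atl ->; split=> //; apply/seteqP; split=> // z _ /=.
by rewrite /slice_dom /= /back gK head_orbit_param_unit.
Qed.

Let Y0 := Q *m X0 *m J *m X0^T *m Q^T.

Let back_Y0 : back Y0 = J.
Proof. by rewrite -[RHS]gK /back /Y0 gE trmx_mul !mulmxA. Qed.

Lemma orbit_chart_base : dom orbit_chart Y0.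
Proof.
split; first by exists X0.
rewrite /slice_dom /= back_Y0.
have c0 : corner a 0 = 0.
  by have := corner_linear a (-1) 0 0; rewrite scaleN1r oppr0 addr0 scaleN1r addNr.
have := head_orbit_param_unit a0 c0.
by rewrite /orbit_param /tilt trmx0 subr0 addr0 mul1mx invmx1 mulmx1.
Qed.

Variable q : nat.

Lemma symmetric_near_GLSym Y : GLSym n q Y ->
  exists U : set 'M[R]_n, [/\ open U, U Y & forall B, U B -> B^T = B -> GLSym n q B].
Proof.
move=> /GLSym_open[eps eps0 epsP]; exists (ball Y eps); split.
- exact: ball_open.
- exact: ballxx.
move=> B UB BT; apply: epsP => // i j; rewrite !mxE.
by apply: ltW; exact: (UB.2 i j).
Qed.

Lemma slice_map_smooth :
  entry_smooth slice_dom (fun Y => slice_map a c1 c2 (back Y)).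
Proof.
have oU := open_slice_dom; apply: entry_smooth_row_mx => //.
  by apply: entry_smooth_lin => //; exact: slope_smooth.
apply: entry_smooth_lin => //; apply: entry_smoothB => //; first exact: back_smooth.
apply: orbit_param_smooth slope_smooth => // x _.
exact: slope_corner.
Qed.

Lemma slice_inv_smooth :
  entry_smooth setT (fun v => g *m slice_inv a r1 r2 v *m g^T).
Proof.
have oT : open [set: 'rV[R]_(d + e)] by exact: openT.
have ids := entry_smooth_id oT.
have ks : entry_smooth setT (fun v : 'rV[R]_(d + e) => r1 (lsubmx v)).
  by apply: (entry_smooth_lin r1) => //; apply: (entry_smooth_lin lsubmx).
have r2s : entry_smooth setT (fun v : 'rV[R]_(d + e) => r2 (rsubmx v)).
  by apply: (entry_smooth_lin r2) => //; apply: (entry_smooth_lin rsubmx).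
have os := orbit_param_smooth oT (fun v _ => r1c _) ks.
have [cs _] := entry_smooth_corner_head oT os.
have ws := entry_smoothD oT r2s
  (entry_smoothB oT (entry_smoothB oT os cs) (entry_smooth_tr oT cs)).
have [_ hs] := entry_smooth_corner_head oT ws.
have Ns := entry_smoothM oT ks hs.
apply: conj_smooth => //.
exact: entry_smoothD oT (entry_smoothD oT ws Ns) (entry_smooth_tr oT Ns).
Qed.

Lemma slice_chart : S `<=` GLSym n q ->
  exists c : chart R 'M[R]_n (d + e),
    [/\ embedded_atlas (d + e) (GLSym n q) c, dom c Y0 &
        cmap c @` (dom c `&` S) =
        cod c `&` [set v | forall j : 'I_(d + e), (d <= j)%N -> v 0 j = 0]].
Proof.
move=> SN; have [S0 D0] := orbit_chart_base.
have [U [oU UY UN]] := symmetric_near_GLSym (SN _ S0).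
pose cm Y := slice_map a c1 c2 (back Y).
pose ci v := g *m slice_inv a r1 r2 v *m g^T.
have backci v : back (ci v) = slice_inv a r1 r2 v by rewrite /back gK.
have [|||||atl codE] := @embedded_chart R n n (d + e) (GLSym n q) (slice_dom `&` U) cm ci.
- by apply: openI => //; exact: open_slice_dom.
- by apply: entry_smooth_sub slice_map_smooth => Y [].
- exact: slice_inv_smooth.
- move=> Y [_ YT _] [DY _]; rewrite /ci /cm (slice_mapK a0 r1E r2E) ?gTK //.
  exact: back_sym.
- move=> v [Dv Uv]; split.
    apply: UN => //; rewrite /ci !trmx_mul trmxK mulmxA; congr (_ *m _ *m _).
    exact: (slice_invT a0 c1K r1E c2K r2E).
  rewrite /cm backci (slice_invK a0 c1K r1E c2K r2E) //.
  by move: Dv; rewrite /slice_dom /= backci.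
exists (Chart (GLSym n q `&` (slice_dom `&` U)) cm ci); split=> //.
  by split=> //; exact: SN.
rewrite codE; apply/seteqP; split=> [v [Y [[NY [DY UY']] SY] <-]|v [Uv v0]].
  have SO := (back_orbit Y).1 SY.
  have ciK : ci (cm Y) = Y.
    by rewrite /ci /cm (slice_mapK a0 r1E r2E) ?gTK //; apply: back_sym; case: NY.
  split=> [|j dj]; first by rewrite /= ciK.
  rewrite /cm /slice_map /= orbit_param_slope // subrr linear0.
  case: (split_ordP j) dj => l -> /=; first by rewrite leqNgt ltn_ord.
  by rewrite row_mxEr mxE.
have vE : v = row_mx (lsubmx v) 0.
  rewrite -[LHS]hsubmxK; congr row_mx; apply/matrixP => i j.
  by rewrite ord1 mxE [RHS]mxE v0 //= leq_addr.
have ciE : ci v = g *m orbit_param a (r1 (lsubmx v)) *m g^T.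
  by rewrite {1}vE /ci (slice_inv_orbit a0 r2 c1K r1E).
have SY : S (ci v).
  by apply/back_orbit; rewrite ciE /back gK; exact: orbit_param_orbit.
exists (ci v); first by split=> //; split; [exact: SN|].
rewrite -[LHS]/(cm (ci v)) /cm backci (slice_invK a0 c1K r1E c2K r2E) //.
by case: Uv => Dv _; move: Dv; rewrite /slice_dom /= backci.
Qed.

Lemma orbit_chart_section : exists s : 'rV[R]_d -> 'M[R]_n,
  smooth setT s /\ forall z, G (s z) /\
    Q *m s z *m J *m (s z)^T *m Q^T = cinv orbit_chart z.
Proof.
have [s [ss sP]] := smooth_orbit_section a0 r1_smooth r1c.
exists (fun z => X0 *m s z); split.
  apply: entry_smooth_smooth; first exact: openT.
  apply: entry_smoothM => //; [exact: openT|exact: entry_smooth_cst].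
move=> z; have [so sJ sE] := sP z; split; first by apply: GM => //; apply/GP.
by rewrite /= -sE gE !trmx_mul !mulmxA.
Qed.

End Base.

Lemma GLSym_manifold q : embedded_manifold (d + e) (GLSym n q : set 'M[R]_n).
Proof.
move=> Y0 NY0; have [U [oU UY UN]] := symmetric_near_GLSym NY0.
have [|||||atl codE] := @embedded_chart R n n (d + e) (GLSym n q) U
    (lin_map c1 c2) (lin_inv r1 r2).
- exact: oU.
- by apply: entry_smooth_row_mx => //; apply: entry_smooth_lin => //;
    exact: entry_smooth_id.
- have oT : open [set: 'rV[R]_(d + e)] by exact: openT.
  have ids := entry_smooth_id oT.
  have ks : entry_smooth setT (fun v : 'rV[R]_(d + e) => r1 (lsubmx v)).
    by apply: (entry_smooth_lin r1) => //; apply: (entry_smooth_lin lsubmx).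
  apply: entry_smoothD => //; last exact: entry_smooth_tr.
  apply: entry_smoothD => //.
  by apply: (entry_smooth_lin r2) => //; apply: (entry_smooth_lin rsubmx).
- by move=> Y [_ YT _] _; exact: (lin_mapK r1E r2E).
- move=> v Uv; split; last exact: (lin_invK c1K r1E c2K r2E).
  by apply: UN => //; exact: (lin_invT _ c2K r2E).
by exists (Chart (GLSym n q `&` U) (lin_map c1 c2) (lin_inv r1 r2)).
Qed.

Lemma orbit_submanifold q : S `<=` GLSym n q -> submanifold d (GLSym n q) S.
Proof.
move=> SN; split=> //; exists (d + e)%N; split; first exact: leq_addr.
  exact: GLSym_manifold.
by move=> Y [X0 X0G <-]; exact: (slice_chart X0G erefl).
Qed.

Let act X := Q *m X *m J *m X^T *m Q^T.

Let act_S X : G X -> S (act X). Proof. by exists X. Qed.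

Let HG X : H X -> G X.
Proof.
move=> [[Xu XJ] Xo]; apply/GP; split=> //.
by rewrite -(mulmxA J) XJ (mulmxA J) XJ mulmxA.
Qed.

Let act_H X Y : H Y -> act (X *m Y) = act X.
Proof.
move=> [[_ YJ] Yo]; rewrite /act trmx_mul !mulmxA; congr (_ *m _ *m _).
by rewrite -(mulmxA _ Y J) -YJ !mulmxA -(mulmxA _ Y) Yo mulmx1.
Qed.

Let act_inj X Y : G X -> G Y -> act X = act Y -> H (X^T *m Y).
Proof.
move=> GX GY; have /GP[Xo XJ] := GX; have /GP[Yo YJ] := GY => XY.
have {}XY : X *m J *m X^T = Y *m J *m Y^T.
  have := congr1 (fun Z => Q^T *m Z *m Q) XY; rewrite /act !mulmxA orthoE //.
  by rewrite !mul1mx -!(mulmxA _ Q^T) orthoE // !mulmx1.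
have o : orthogonal_group n (X^T *m Y) by apply: orthoM => //; exact: orthoT.
split=> //; split; first exact: ortho_unit.
have := congr1 (fun Z => X^T *m Z *m Y) XY; rewrite !mulmxA orthoE // mul1mx.
by rewrite -!(mulmxA _ Y^T) orthoE // mulmx1 -!mulmxA.
Qed.

(** [xget] picks any representative of the coset; [act] takes the same value on
    all of them. *)
Definition of_coset (C : set 'M[R]_n) := act (xget 0 C).
Definition to_coset Y : set 'M[R]_n := [set X | G X /\ act X = Y].

Let H1 : H 1%:M.
Proof.
split; first by split; rewrite ?unitmx1 ?mulmx1 ?mul1mx.
by rewrite /orthogonal_group /= trmx1 mulmx1.
Qed.

Let of_cosetE X : of_coset (lcoset H X) = act X.
Proof.
rewrite /of_coset; case: xgetP => [Y _ [k Hk <-]|/(_ X) []]; first exact: act_H.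
by exists 1%:M => //; rewrite mulmx1.
Qed.

Let to_cosetE X : G X -> to_coset (act X) = lcoset H X.
Proof.
move=> GX; apply/seteqP; split=> [Y [GY YX]|_ [k Hk <-]].
  exists (X^T *m Y); first exact: act_inj.
  by have /GP[Xo _] := GX; rewrite mulmxA [X *m _]Xo mul1mx.
by split; [apply: GM => //; exact: HG | exact: act_H].
Qed.

Let of_to Y : S Y -> of_coset (to_coset Y) = Y.
Proof. by move=> [X GX <-]; rewrite to_cosetE // of_cosetE. Qed.

Section HomogeneousChart.
Variables X0 g : 'M[R]_n.
Hypotheses (X0G : G X0) (gE : g = Q *m X0).
Let b := orbit_chart g.

(** The charts of the homogeneous space are those of the orbit, carried by the
    bijection; in these charts the bijection and its inverse read as the
    identity. *)
Definition coset_chart : chart R (set 'M[R]_n) d :=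
  Chart [set C | coset_space G H C /\ dom b (of_coset C)]
    (cmap b \o of_coset) (to_coset \o cinv b).

Let b_dom z : dom b (cinv b z) /\ cmap b (cinv b z) = z.
Proof.
have [[[_ bK] _ _ _] codE] := orbit_chartP X0G gE.
have : cod b z by rewrite codE.
by move=> [Y DY <-]; rewrite bK.
Qed.

Let b_S Y : dom b Y -> S Y. Proof. by case. Qed.

Lemma coset_chart_cod : cod coset_chart = setT.
Proof.
apply/seteqP; split=> // z _; have [Db bz] := b_dom z.
have [X GX XE] := b_S Db; exists (lcoset H X) => /=.
  by split; [exists X | rewrite of_cosetE /act XE].
by rewrite of_cosetE /act XE.
Qed.

Lemma coset_chartP : homogeneous_atlas d G H coset_chart.
Proof.
have bK Y : dom b Y -> cinv b (cmap b Y) = Y.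
  by have [[[_ bK] _ _ _] _] := orbit_chartP X0G gE; exact: bK.
have oU0 : open (slice_dom g) by exact: open_slice_dom.
pose U := act @^-1` (slice_dom g).
have acts (W : set 'M[R]_n) : open W -> entry_smooth W act.
  move=> oW; have ids := entry_smooth_id oW.
  apply: entry_smoothM => //; last exact: entry_smooth_cst.
  apply: entry_smoothM => //; last exact: entry_smooth_tr.
  apply: entry_smoothM => //; last exact: entry_smooth_cst.
  by apply: entry_smoothM => //; exact: entry_smooth_cst.
have oU : open U.
  apply: open_comp => // X _; apply: entry_smooth_continuous openT _ I.
  by apply: acts; exact: openT.
have preE : [set X | G X /\ dom coset_chart (lcoset H X)] = G `&` U.
  apply/seteqP; split=> [X /= [GX [_ []]]|X [GX UX]] /=.
    by rewrite of_cosetE.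
  split=> //; split; first by exists X.
  by rewrite of_cosetE; split=> //; exact: act_S.
split.
- split; first by rewrite coset_chart_cod; exact: openT.
  move=> C [[X GX <-] DC].
  rewrite -[LHS]/(to_coset (cinv b (cmap b (of_coset (lcoset H X))))).
  by rewrite bK // of_cosetE to_cosetE.
- by move=> C [].
- by exists U.
- move=> X; rewrite preE => -[GX UX].
  exists U, (fun X => c1 (slope a (g^T *m act X *m g))); split=> //.
    apply: entry_smooth_smooth => //; apply: entry_smooth_lin => //.
    have Fs : entry_smooth U (fun X => g^T *m act X *m g).
      apply: entry_smoothM => //; last exact: entry_smooth_cst.
      by apply: entry_smoothM; [|exact: entry_smooth_cst|exact: acts].
    have [cs hs] := entry_smooth_corner_head oU Fs.
    by apply: entry_smoothM => //; apply: entry_smooth_inv.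
  by move=> Y _ /=; rewrite of_cosetE.
move=> y _; have [s [ss sP]] := orbit_chart_section X0G gE.
exists setT, s; split=> // [|z _|z _]; first exact: openT.
  by rewrite coset_chart_cod.
have [Gs sE] := sP z; split=> //.
by rewrite -[RHS]/(to_coset (cinv b z)) -sE to_cosetE.
Qed.

Lemma coset_chart_id (f : 'rV[R]_d -> 'rV[R]_d) (A : set 'rV[R]_d) :
  f =1 id -> smooth_on A f.
Proof.
move=> fE z _; exists setT, id; split=> //; first exact: openT.
by apply: entry_smooth_smooth; [exact: openT | apply: entry_smooth_id; exact: openT].
Qed.

Lemma coset_chart_of_coset : smooth_on (cod coset_chart)
  (cmap b \o of_coset \o cinv coset_chart).
Proof.
apply: coset_chart_id => z; have [Db bz] := b_dom z.
rewrite -[LHS]/(cmap b (of_coset (to_coset (cinv b z)))).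
rewrite of_to //; exact: b_S.
Qed.

Lemma coset_chart_to_coset : smooth_on (cod b)
  (cmap coset_chart \o to_coset \o cinv b).
Proof.
apply: coset_chart_id => z; have [Db bz] := b_dom z.
rewrite -[LHS]/(cmap b (of_coset (to_coset (cinv b z)))).
rewrite of_to //; exact: b_S.
Qed.

End HomogeneousChart.

Lemma orbit_diffeomorphic :
  diffeomorphic (coset_space G H) (homogeneous_atlas d G H)
                S (embedded_atlas d S).
Proof.
exists of_coset, to_coset; split.
- by move=> _ [_ [X GX <-] <-]; rewrite of_cosetE; exact: act_S.
- by move=> _ [_ [X GX <-] <-]; exists X => //; rewrite -to_cosetE.
- split=> [_ [X GX <-]|Y SY]; last exact: of_to.
  by rewrite of_cosetE to_cosetE.
- move=> _ [X GX <-]; pose g := Q *m X.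
  have DX : dom (orbit_chart g) (act X) by exact: (orbit_chart_base GX erefl).
  exists (coset_chart g), (orbit_chart g); split.
  + exact: (coset_chartP GX erefl).
  + by have [] := orbit_chartP GX (erefl g).
  + by split; [exists X | rewrite of_cosetE].
  + by move=> _ [C [_ DC] <-].
  exact: (coset_chart_of_coset GX erefl).
move=> _ [X GX <-]; pose g := Q *m X.
have DX : dom (orbit_chart g) (act X) by exact: (orbit_chart_base GX erefl).
exists (orbit_chart g), (coset_chart g); split.
+ by have [] := orbit_chartP GX (erefl g).
+ exact: (coset_chartP GX erefl).
+ exact: DX.
+ move=> _ [Y DY <-]; have SY : S Y by case: DY.
  split; last by rewrite of_to.
  by have [X' GX' <-] := SY; exists X' => //; rewrite -to_cosetE.
exact: (coset_chart_to_coset GX erefl).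
Qed.

End Manifold.

Theorem orbit_manifold (R : realType) n (a : 'rV[R]_n) (Q : 'M[R]_n) q :
  (forall i, a 0 i != 0) -> orthogonal_group n Q ->
  conj_orbit a Q `<=` GLSym n q ->
  exists d, submanifold d (GLSym n q) (conj_orbit a Q) /\
    let G := centralizer (diag_mx a *m diag_mx a) `&` orthogonal_group n in
    let H := centralizer (diag_mx a) `&` orthogonal_group n in
    diffeomorphic (coset_space G H) (homogeneous_atlas d G H)
                  (conj_orbit a Q) (embedded_atlas d (conj_orbit a Q)).
Proof.
move=> a0 Qo SN.
have [d [c1 [r1 [c1K r1E]]]] := projection_coords (@corner_linear _ _ a) (cornerK a).
have [e [c2 [r2 [c2K r2E]]]] :=
  projection_coords (@sym_off_corner_linear _ _ a) (sym_off_cornerK a).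
exists d; split; first exact: (orbit_submanifold a0 Qo c1K r1E c2K r2E).
exact: (orbit_diffeomorphic a0 Qo c1K r1E).
Qed.

(** * Symmetric square roots with prescribed eigenvalues *)

Section Blocks.
Variable R : realType.

(** By the equality of sizes, nothing is left in [s] outside of [t]. *)
Lemma perm_eq_count (s t : seq R) : size s = size t ->
  {in t, forall x, count_mem x s = count_mem x t} -> perm_eq s t.
Proof.
move=> st ct; pose s' := [seq x <- s | x \in t].
have s't : perm_eq s' t.
  apply/allP => x; rewrite mem_cat mem_filter => xt.
  have {}xt : x \in t by case/orP: xt => // /andP[].
  rewrite /= -ct // /s' count_filter; apply/eqP/eq_count => y /=.
  by case: eqVneq => [->|//]; rewrite xt.
suff /all_filterP <- : all (mem t) s by [].
by rewrite all_count -size_filter -/s' (perm_size s't) st.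
Qed.

Lemma sum_prefix (h u b c : nat) : (u <= h)%N ->
  (\sum_(j < h) (if j < u then b else c) = u * b + (h - u) * c)%N.
Proof.
move=> uh; rewrite -(big_mkord xpredT (fun j => if j < u then b else c)%N).
rewrite (big_cat_nat _ uh) //=; congr (_ + _)%N.
  rewrite -[in RHS](subn0 u) -sum_nat_const_nat; apply: eq_big_nat => j /andP[_ ju].
  by rewrite ju.
rewrite -sum_nat_const_nat; apply: eq_big_nat => j /andP[uj _].
by rewrite ltnNge uj.
Qed.

Definition sign_row (h u : nat) (x : R) : 'rV[R]_h :=
  \row_j (if (j < u)%N then x else - x).

Lemma count_sum n (d : 'rV[R]_n) (P : pred R) :
  count P [tuple d 0 i | i < n] = (\sum_(i < n) P (d 0%R i))%N.
Proof.
rewrite /= count_map -sum1_count big_mkcond /= big_enum.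
by apply: eq_bigr => i _; case: P.
Qed.

Lemma count_sign_row h u x (P : pred R) : (u <= h)%N ->
  count P [tuple sign_row h u x 0 i | i < h] = (u * P x + (h - u) * P (- x))%N.
Proof.
move=> uh; rewrite count_sum -sum_prefix //; apply: eq_bigr => j _.
by rewrite mxE; case: ifP.
Qed.

Lemma sign_rowE h u x :
  diag_mx (sign_row h u x) = x *: (pid_mx u - copid_mx u).
Proof.
apply/matrixP => i j; rewrite !mxE /=; have [->|ij] := eqVneq i j.
  by rewrite eqxx; case: ifP => _; rewrite !mulr1n ?subrr ?subr0 ?mulr1 // sub0r mulrN1.
rewrite (_ : (i == j :> nat) = false) ?mulr0n ?subr0 ?mulr0 //.
by apply/negbTE.
Qed.

Lemma sign_row_sqr h u x :
  diag_mx (sign_row h u x) *m diag_mx (sign_row h u x) = (x ^+ 2)%:M.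
Proof.
rewrite mulmx_diag; apply/matrixP => i j; rewrite !mxE; congr (_ *+ _).
by case: ifP => _; rewrite ?mulrNN.
Qed.

(** A symmetric orthogonal matrix squares to 1, so its eigenvalues are 1 and -1
    and the signature is their multiplicity. *)
Lemma ortho_GLSymP h u (B : 'M[R]_h) : (u <= h)%N ->
  (orthogonal_group h `&` GLSym h u) B <->
  exists2 X, orthogonal_group h X & B = X *m diag_mx (sign_row h u 1) *m X^T.
Proof.
move=> uh; split=> [[Bo BS]|[X Xo ->]]; last first.
  split.
    rewrite /orthogonal_group /= !trmx_mul trmxK tr_diag_mx !mulmxA.
    rewrite -(mulmxA _ X^T) orthoE // mulmx1 -(mulmxA X) sign_row_sqr expr1n.
    by rewrite mulmx1.
  apply/GLSymP; exists X, (sign_row h u 1); split=> // [i|].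
    by rewrite mxE; case: ifP => _; rewrite ?oppr_eq0 oner_eq0.
  by rewrite -count_row count_sign_row // ltr01 oppr_gt0 ltr10 muln0 addn0 muln1.
have /GLSymP[X [d [Xo BE d0 dq]]] := BS.
have d1 i : d 0 i = 1 \/ d 0 i = -1.
  have DD : diag_mx d *m diag_mx d = 1%:M.
    have : B *m B^T = 1%:M by [].
    rewrite BE !trmx_mul trmxK tr_diag_mx !mulmxA -(mulmxA _ X^T) orthoE // mulmx1.
    move=> /(congr1 (fun Z => X^T *m Z *m X)); rewrite !mulmxA orthoE // mul1mx.
    by rewrite -!(mulmxA _ X^T) mulmx1 orthoE // mulmx1.
  move/matrixP/(_ i i): DD; rewrite mulmx_diag !mxE eqxx !mulr1n -expr2 => /eqP.
  by rewrite sqrf_eq1 => /orP[/eqP|/eqP]; [left|right].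
apply: symmetric_conj_diag; first by case: BS.
rewrite BE char_poly_conj // !char_poly_diag; apply: perm_big.
apply: perm_eq_count; first by rewrite !size_tuple.
have c1 : count_mem 1 [tuple d 0 i | i < h] = u.
  rewrite count_row -dq; apply: eq_card => i; rewrite !inE.
  case: (d1 i) => ->; rewrite ?eqxx ?ltr01 // oppr_gt0 ltr10.
  by rewrite -subr_eq0 -opprD oppr_eq0 paddr_eq0 ?oner_eq0.
have cN1 : count_mem (-1) [tuple d 0 i | i < h] = (h - u)%N.
  rewrite count_row -dq cardsCs card_ord; congr (_ - _)%N; apply: eq_card => i.
  rewrite !inE; case: (d1 i) => ->; rewrite ?ltr01 ?eqxx ?oppr_gt0 ?ltr10 //.
  by rewrite eq_sym -subr_eq0 -opprD oppr_eq0 paddr_eq0 ?oner_eq0.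
have N11 : (-1 == 1 :> R) = false.
  by rewrite -subr_eq0 -opprD oppr_eq0 paddr_eq0 ?ler01 ?oner_eq0.
move=> x /mapP[i _ ->].
rewrite [count_mem _ (tval [tuple sign_row h u 1 0 i | i < h])]count_sign_row //.
rewrite mxE; case: ifP => _ /=.
  by rewrite c1 eqxx N11 muln0 addn0 muln1.
by rewrite cN1 eqxx eq_sym N11 muln0 add0n muln1.
Qed.

Lemma mxdiagM p (h : 'I_p -> nat) (A B : forall i, 'M[R]_(h i)) :
  \mxdiag_i A i *m \mxdiag_i B i = \mxdiag_i (A i *m B i).
Proof.
rewrite {2}/mxdiag mul_mxdiag_mxblock; apply: eq_mxblock => i j.
by case: eqVneq => [<-|_]; rewrite ?conform_mx_id ?mulmx0.
Qed.

End Blocks.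

Section RJAForm.
Import tagnat.
Variables (R : realType) (p : nat) (lam : 'I_p -> R) (h u : 'I_p -> nat).
Hypotheses (lam_lt : forall i j : 'I_p, (i < j)%N -> lam i < lam j)
  (lam_gt0 : forall i, 0 < lam i) (u_le : forall i, (u i <= h i)%N).
Let n := (\sum_(i < p) h i)%N.

Definition RJA_row : 'rV[R]_n := \mxrow_i sign_row (h i) (u i) (Num.sqrt (lam i)).
Let a := RJA_row.

Lemma RJA_diag : RJA lam h u = diag_mx a.
Proof. by rewrite diag_mxrow; apply: eq_mxdiag => i; rewrite sign_rowE. Qed.

Lemma RJA_rowE k : a 0 k = if (sig2 k < u (sig1 k))%N then Num.sqrt (lam (sig1 k))
  else - Num.sqrt (lam (sig1 k)).
Proof. by rewrite !mxE. Qed.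

Let s_gt0 i : 0 < Num.sqrt (lam i). Proof. by rewrite sqrtr_gt0. Qed.

Lemma RJA_row_neq0 k : a 0 k != 0.
Proof. by rewrite RJA_rowE; case: ifP => _; rewrite ?oppr_eq0 gt_eqF. Qed.

Lemma lam_inj : injective lam.
Proof.
move=> i j ij; apply/val_inj; case: (ltngtP i j) => // /lam_lt.
  by rewrite ij ltxx.
by rewrite ij ltxx.
Qed.

Lemma sqrt_lam_inj i j : (Num.sqrt (lam i) == Num.sqrt (lam j)) = (i == j).
Proof.
by rewrite eqr_sqrt ?ltW // (inj_eq lam_inj).
Qed.

Lemma sqrt_lam_opp i j : (- Num.sqrt (lam i) == Num.sqrt (lam j)) = false.
Proof. by rewrite lt_eqF // (lt_trans _ (s_gt0 j)) // oppr_lt0. Qed.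

Lemma RJA_sqr : diag_mx a *m diag_mx a = Jordan lam h.
Proof.
rewrite -RJA_diag /RJA mxdiagM; apply: eq_mxdiag => i.
by rewrite -sign_rowE sign_row_sqr sqr_sqrtr // ltW.
Qed.

Lemma count_RJA_row (P : pred R) : count P [tuple a 0 k | k < n] =
  (\sum_i (u i * P (Num.sqrt (lam i)) + (h i - u i) * P (- Num.sqrt (lam i))))%N.
Proof.
rewrite count_sum; under [RHS]eq_bigr => i _ do rewrite -sum_prefix //.
rewrite sig_big_dep (reindex _ sig_bij_on) /=; apply: eq_bigr => k _.
by rewrite RJA_rowE; case: ifP.
Qed.

Lemma count_RJA_pos i : count_mem (Num.sqrt (lam i)) [tuple a 0 k | k < n] = u i.
Proof.
rewrite count_RJA_row (bigD1 i) //= eqxx sqrt_lam_opp muln1 muln0 addn0.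
rewrite big1 ?addn0 // => j ji.
by rewrite sqrt_lam_inj (negPf ji) sqrt_lam_opp !muln0.
Qed.

Lemma count_RJA_neg i :
  count_mem (- Num.sqrt (lam i)) [tuple a 0 k | k < n] = (h i - u i)%N.
Proof.
have E j : (Num.sqrt (lam j) == - Num.sqrt (lam i)) = false.
  by rewrite eq_sym sqrt_lam_opp.
rewrite count_RJA_row (bigD1 i) //= eqxx E muln1 muln0 add0n.
rewrite big1 ?addn0 // => j ji.
by rewrite eqr_opp sqrt_lam_inj (negPf ji) E !muln0.
Qed.

Lemma pos_set_RJA : #|pos_set a| = (\sum_i u i)%N.
Proof.
rewrite -count_row count_RJA_row; apply: eq_bigr => i _.
by rewrite s_gt0 oppr_gt0 (lt_gtF (s_gt0 i)) muln1 muln0 addn0.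
Qed.

(** The prescribed multiplicities add up to [n], so they leave no room for other
    eigenvalues and fix the characteristic polynomial. *)
Lemma SSR_conj (M Y : 'M[R]_n) : SSR M lam h u Y <->
  Y *m Y = M /\ exists2 X, orthogonal_group n X & Y = X *m diag_mx a *m X^T.
Proof.
split=> [[YT YY mult]|[YY [X Xo YE]]]; last first.
  split=> // [|i]; first by rewrite YE !trmx_mul trmxK tr_diag_mx mulmxA.
  by rewrite YE char_poly_conj // char_poly_diag !mu_prod_XsubC count_RJA_pos count_RJA_neg.
split=> //; apply: symmetric_conj_diag => //.
have [X [d [Xo YE]]] := real_spectral YT.
move: mult; rewrite YE char_poly_conj // !char_poly_diag => mult.
apply: perm_big; apply: perm_eq_count; first by rewrite !size_tuple.
move=> x /mapP[k _ ->]; have := mult (sig1 k); rewrite !mu_prod_XsubC => -[m1 m2].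
rewrite RJA_rowE; case: ifP => _.
  by rewrite m1 count_RJA_pos.
by rewrite m2 count_RJA_neg.
Qed.

(** If [Y = X J X^T] squares to [M = Q J^2 Q^T], then [Q^T X] commutes with
    [J^2]. *)
Lemma SSR_orbit (M Q : 'M[R]_n) : orthogonal_group n Q ->
  M = Q *m Jordan lam h *m Q^T -> SSR M lam h u = conj_orbit a Q.
Proof.
move=> Qo ME; apply/seteqP; split=> [Y /SSR_conj[YY [X Xo YE]]|_ [X [[_ XJ] Xo] <-]].
  have o : orthogonal_group n (Q^T *m X) by apply: orthoM => //; exact: orthoT.
  exists (Q^T *m X); last first.
    rewrite trmx_mul trmxK !mulmxA [Q *m _]Qo mul1mx -(mulmxA _ Q Q^T) Qo mulmx1.
    by rewrite YE.
  split=> //; split; first exact: ortho_unit.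
  have E : diag_mx a *m diag_mx a = Q^T *m X *m (diag_mx a *m diag_mx a) *m X^T *m Q.
    have : Q^T *m (Y *m Y) *m Q = diag_mx a *m diag_mx a.
      rewrite YY ME RJA_sqr !mulmxA orthoE // mul1mx -mulmxA orthoE //.
      by rewrite mulmx1.
    by move=> EQ; rewrite -{1}EQ YE !mulmxA -(mulmxA _ X^T X) orthoE // mulmx1.
  rewrite {1}E -!mulmxA (mulmxA Q) [Q *m Q^T]Qo mul1mx orthoE // mulmx1.
  by rewrite !mulmxA.
apply/SSR_conj; split; last first.
  exists (Q *m X); first exact: orthoM.
  by rewrite trmx_mul !mulmxA.
rewrite ME -RJA_sqr !mulmxA -(mulmxA _ Q^T Q) orthoE // mulmx1.
rewrite -(mulmxA _ X^T X) orthoE // mulmx1; congr (_ *m _).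
rewrite -!mulmxA; congr (_ *m _).
by rewrite (mulmxA (diag_mx a)) mulmxA -XJ -!mulmxA [X *m _]Xo mulmx1.
Qed.

Lemma Jordan_comm_mxdiag (X : 'M[R]_n) :
  Jordan lam h *m X = X *m Jordan lam h ->
  X = \mxdiag_i submxblock X i i.
Proof.
have -> : Jordan lam h = diag_mx (\mxrow_i (const_mx (lam i) : 'rV_(h i))).
  by rewrite diag_mxrow; apply: eq_mxdiag => i; rewrite diag_const_mx.
move=> /comm_diagP XJ; rewrite -[LHS]submxblockK; apply: eq_mxblock => i j.
case: eqVneq => [<-|ij]; first by rewrite conform_mx_id.
apply/matrixP => k l; rewrite mxE [RHS]mxE; apply: XJ; rewrite !mxE !Rank1K.
by apply: contra ij => /eqP/lam_inj ->.
Qed.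

Lemma SSR_Jordan_blocks : SSR (Jordan lam h) lam h u =
  mxdiag_set (fun i => [set Num.sqrt (lam i) *: B |
    B in orthogonal_group (h i) `&` GLSym (h i) (u i)]).
Proof.
have o1 : orthogonal_group n (1%:M : 'M[R]_n).
  by rewrite /orthogonal_group /= trmx1 mulmx1.
rewrite (@SSR_orbit _ 1%:M) //; last by rewrite trmx1 mulmx1 mul1mx.
pose K i := diag_mx (sign_row (h i) (u i) (1 : R)).
have RJAE : diag_mx a = \mxdiag_i (Num.sqrt (lam i) *: K i).
  by rewrite -RJA_diag; apply: eq_mxdiag => i; rewrite /K sign_rowE scale1r.
have conjE (X : forall i, 'M[R]_(h i)) :
    \mxdiag_i X i *m diag_mx a *m (\mxdiag_i X i)^T =
    \mxdiag_i (Num.sqrt (lam i) *: (X i *m K i *m (X i)^T)).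
  rewrite RJAE tr_mxdiag !mxdiagM; apply: eq_mxdiag => i.
  by rewrite -scalemxAr -scalemxAl.
have orthoP (X : forall i, 'M[R]_(h i)) :
    orthogonal_group n (\mxdiag_i X i) <-> forall i, orthogonal_group (h i) (X i).
  rewrite /orthogonal_group /= tr_mxdiag mxdiagM -(mxdiagZ 1).
  by split=> [/eq_mxdiagP|H]; [|apply: eq_mxdiag].
apply/seteqP; split=> [_ [X [[_ XJ] Xo] <-]|_ [B BP <-]].
  move: XJ; rewrite RJA_sqr => /Jordan_comm_mxdiag XE.
  exists (fun i => Num.sqrt (lam i) *: (submxblock X i i *m K i *m (submxblock X i i)^T)).
    move=> i; exists (submxblock X i i *m K i *m (submxblock X i i)^T) => //.
    apply/ortho_GLSymP => //; exists (submxblock X i i) => //.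
    by apply/orthoP: i; rewrite -XE.
  by rewrite -conjE -XE trmx1 mulmx1 mul1mx.
have ex i : exists X, orthogonal_group (h i) X /\
    B i = Num.sqrt (lam i) *: (X *m K i *m X^T).
  by have [C /ortho_GLSymP[//|X Xo ->] <-] := BP i; exists X.
pose X i := projT1 (cid (ex i)).
have XP i : orthogonal_group (h i) (X i) /\
    B i = Num.sqrt (lam i) *: (X i *m K i *m (X i)^T) by exact: projT2 (cid (ex i)).
have Xo : orthogonal_group n (\mxdiag_i X i) by apply/orthoP => i; have [] := XP i.
exists (\mxdiag_i X i).
  split=> //; split; first exact: ortho_unit.
  rewrite RJA_sqr /Jordan !mxdiagM; apply: eq_mxdiag => i.
  by rewrite scalar_mxC.
rewrite mul1mx trmx1 mulmx1 conjE; apply: eq_mxdiag => i.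
by have [_ <-] := XP i.
Qed.

End RJAForm.

Section Compact.
Variable R : realType.

Lemma ortho_entry n (X : 'M[R]_n) i j : orthogonal_group n X -> `|X i j| <= 1.
Proof.
move=> /matrixP/(_ i i); rewrite !mxE eqxx (bigD1 j) //= mxE => E.
have X1 : X i j ^+ 2 <= 1.
  rewrite -[leRHS]/((1 *+ true)%R : R) -E expr2 lerDl sumr_ge0 // => k _.
  by rewrite mxE -expr2 sqr_ge0.
by rewrite -(@ler_pXn2r _ 2) ?nnegrE // real_normK ?num_real // expr1n.
Qed.

(** The group of orthogonal matrices commuting with [J^2] is closed and bounded;
    it is transported to row vectors, where closed bounded sets are compact. *)
Lemma conj_orbit_compact n (a : 'rV[R]_n) (Q : 'M[R]_n) : compact (conj_orbit a Q).
Proof.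
pose J := diag_mx a; pose act X : 'M[R]_n := Q *m X *m J *m X^T *m Q^T.
pose D := [set v : 'rV[R]_(n * n) | orthogonal_group n (vec_mx v) /\
  (J *m J) *m vec_mx v = vec_mx v *m (J *m J)].
have oT : open [set: 'rV[R]_(n * n)] by exact: openT.
have vs : entry_smooth setT (fun v : 'rV[R]_(n * n) => vec_mx v : 'M[R]_n).
  by apply: (entry_smooth_lin vec_mx) => //; exact: entry_smooth_id.
have cs (A : 'M[R]_n) : entry_smooth [set: 'rV[R]_(n * n)] (fun=> A).
  exact: entry_smooth_cst.
have -> : conj_orbit a Q = (act \o vec_mx) @` D.
  apply/seteqP; split=> [_ [X [[_ XJ] Xo] <-]|_ [v [vo vJ] <-]].
    by exists (mxvec X); rewrite /D /= mxvecK.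
  by exists (vec_mx v) => //; split=> //; split=> //; exact: ortho_unit.
apply: continuous_compact.
  apply: continuous_subspaceT => v.
  apply: (entry_smooth_continuous oT) => //.
  do 4?[apply: entry_smoothM => //]; exact: entry_smooth_tr.
apply: bounded_closed_compact.
  exists 1; split=> // r r1 v [vo _]; apply: le_trans (ltW r1).
  have [->|v0] := eqVneq `|v| 0; first exact: ler01.
  have [[i j] /= vE] := mx_norm_neq0 v0.
  have {vE}-> : `|v| = `|v i j| by exact: vE.
  case/mxvec_indexP: j => k l; rewrite ord1 -[v]vec_mxK mxvecE.
  exact: ortho_entry.
have cl1 (A : 'M[R]_n) : closed [set A].
  by apply: accessible_closed_set1; apply: hausdorff_accessible; exact: norm_hausdorff.
have -> : D = (fun v => vec_mx v *m (vec_mx v)^T) @^-1` [set (1%:M : 'M[R]_n)] `&`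
  (fun v => (J *m J) *m vec_mx v - vec_mx v *m (J *m J)) @^-1` [set (0 : 'M[R]_n)].
  apply/seteqP; split=> v [v1 v2]; split=> //=; first by rewrite v2 subrr.
  by apply/eqP; rewrite -subr_eq0; apply/eqP.
apply: closedI; apply: closed_comp => // v _.
  apply: (entry_smooth_continuous oT) => //.
  by apply: entry_smoothM => //; exact: entry_smooth_tr.
apply: (entry_smooth_continuous oT) => //.
by apply: entry_smoothB => //; apply: entry_smoothM.
Qed.

End Compact.

Theorem proposition3p3 (R : realType) (p : nat) (lam : 'I_p -> R)
    (h u : 'I_p -> nat) (M Q : 'M[R]_(\sum_(i < p) h i))
    (Msym : M^T = M) (Mpos : posdef M)
    (lam_lt : forall i j : 'I_p, (i < j)%N -> lam i < lam j)
    (lam_gt0 : forall i, 0 < lam i)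
    (lam_all : forall a : R, eigenvalue M a -> exists i, a = lam i)
    (h_gt0 : forall i, (0 < h i)%N)
    (h_mult : forall i, mup (lam i) (char_poly M) = h i)
    (Qorth : orthogonal_group _ Q)
    (MQ : M = Q *m Jordan lam h *m Q^T)
    (u_le : forall i, (u i <= h i)%N) :
  [/\ SSR M lam h u =
        [set Q *m X *m RJA lam h u *m X^T *m Q^T |
           X in centralizer (Jordan lam h) `&` orthogonal_group _],
      SSR M lam h u = Gamma Q @` SSR (Jordan lam h) lam h u,
      SSR (Jordan lam h) lam h u =
        mxdiag_set (fun i =>
          [set Num.sqrt (lam i) *: B |
             B in orthogonal_group (h i) `&` GLSym (h i) (u i)]),
      compact (SSR M lam h u) &
      exists d : nat,
        submanifold d (GLSym _ (\sum_(i < p) u i)%N) (SSR M lam h u) /\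
        let G := centralizer (Jordan lam h) `&` orthogonal_group _ in
        let H := centralizer (RJA lam h u) `&` orthogonal_group _ in
        diffeomorphic (coset_space G H) (homogeneous_atlas d G H)
                      (SSR M lam h u) (embedded_atlas d (SSR M lam h u))].
Proof.
pose a := RJA_row lam h u.
have SE := SSR_orbit lam_lt lam_gt0 u_le Qorth MQ.
have JE : Jordan lam h = diag_mx a *m diag_mx a by rewrite RJA_sqr.
have o1 : orthogonal_group _ (1%:M : 'M[R]_(\sum_(i < p) h i)).
  by rewrite /orthogonal_group /= trmx1 mulmx1.
have SJE : SSR (Jordan lam h) lam h u = conj_orbit a 1%:M.
  by apply: SSR_orbit => //; rewrite trmx1 mulmx1 mul1mx.
split.
- by rewrite SE JE RJA_diag.
- rewrite SE SJE; apply/seteqP; split=> [_ [X XG <-]|_ [_ [X XG <-] <-]].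
    exists (X *m diag_mx a *m X^T); last by rewrite /Gamma !mulmxA.
    by exists X => //; rewrite mul1mx trmx1 mulmx1.
  by exists X => //; rewrite /Gamma mul1mx trmx1 mulmx1 !mulmxA.
- exact: SSR_Jordan_blocks.
- by rewrite SE; exact: conj_orbit_compact.
rewrite SE JE RJA_diag; apply: orbit_manifold => // [k|].
  exact: RJA_row_neq0.
move=> _ [X [_ Xo] <-]; apply/GLSymP; exists (Q *m X), a; split.
- exact: orthoM.
- by rewrite trmx_mul !mulmxA.
- by move=> k; exact: RJA_row_neq0.
exact: pos_set_RJA.
Qed.
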